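(* Let $\mathcal{C}=\langle E,c,\{\mathcal{R}_i\}_{i=1}^n\rangle$ be a covering problem and $\lambda\ge1$. Suppose there is a polynomial-time $\alpha_{off}$-approximation algorithm for the augmentation problem of $\mathcal{C}$ and a polynomial-time deterministic $\alpha_{on}$-competitive online algorithm for $\mathcal{C}$. Then there is an $O((p+1)\,\alpha_{off}\,\alpha_{on})$-approximation algorithm for the robust covering problem $\langle E,c,\{\mathcal{R}_i\}_{i=1}^n,\Sigma,\lambda\rangle$ whenever the uncertainty set is $\Sigma=\bigcup_{j=1}^L\Sigma_j$, where $L$ is polynomial in $n$ and each $\Sigma_j\subseteq2^{[n]}$ is a $p$-system given by a membership oracle.
   Context: A covering problem $\mathcal{C}=\langle E,c,\{\mathcal{R}_i\}_{i=1}^n\rangle$ has a finite ground set $E$ with costs $c:E\to\mathbb{R}_{\ge0}$ ($c(F)=\sum_{e\in F}c_e$) and requirements $i\in[n]$, each given by an upward-closed family $\mathcal{R}_i\subseteq2^E$; $F$ satisfies $i$ iff $F\in\mathcal{R}_i$. For $S\subseteq E$, $X\subseteq[n]$: $\mathrm{Opt}_{aug}(X\mid S)=\min\{c(A):A\subseteq E,\ S\cup A\in\mathcal{R}_i\ \forall i\in X\}$, $\mathrm{Opt}(X)=\mathrm{Opt}_{aug}(X\mid\emptyset)$. An $\alpha_{off}$-approximation algorithm for the augmentation problem, given $S,X$, outputs $A$ with $S\cup A\in\mathcal{R}_i$ for all $i\in X$ and $c(A)\le\alpha_{off}\mathrm{Opt}_{aug}(X\mid S)$. In the online version, requirements arrive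 one by one in a sequence $\sigma$; a deterministic online algorithm $\mathcal{A}_{on}$ maintains $\mathcal{A}_{on}(\sigma)\subseteq E$ satisfying all arrived requirements, only adding elements; it is $\alpha_{on}$-competitive if $c(\mathcal{A}_{on}(\sigma))\le\alpha_{on}\mathrm{Opt}(\text{requirements in }\sigma)$ for all $\sigma$. A $p$-system is a downward-closed family $\mathcal{M}\subseteq2^{[n]}$ such that for every $A\subseteq[n]$ any two inclusion-maximal members of $\mathcal{M}$ contained in $A$ have sizes within factor $p$. Robust covering problem $\langle E,c,\{\mathcal{R}_i\},\Sigma,\lambda\rangle$: a solution is a first-stage set $E_0\subseteq E$ plus an augmentation procedure giving, for each $\omega\in\Sigma$, a set $E_\omega\subseteq E$ with $E_0\cup E_\omega\in\mathcal{R}_i$ for all $i\in\omega$; minimize $c(E_0)+\lambda\max_{\omega\in\Sigma}c(E_\omega)$. A $\rho$-approximation algorithm outputs a solution of objective at most $\rho$ times optimal. *)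

(* Defs.v *)
From mathcomp Require Import all_boot all_order all_algebra.

Set Implicit Arguments.
Unset Strict Implicit.
Unset Printing Implicit Defensive.

Import Order.TTheory GRing.Theory Num.Theory.
Local Open Scope ring_scope.

(* Polynomial time is formalized by a while-language over binary trees whose
   leaves may carry numbers of R: every executed command costs one step and
   arithmetic on R is exact and unit-cost, as on a real RAM.  No constants of R
   other than 0 and 1 are available.  Trees are shared, so copying or consing
   is a single step, as on a pointer machine. *)

Inductive tree (R : Type) : Type :=
| Leaf
| Scalar of R
| Node of tree R & tree R.
Arguments Leaf {R}.

Inductive expr : Type :=
| Var of nat
| ENil
| EPair of expr & expr
| EFst of expr
| ESnd of expr
| EIsNum of expr
| EZero
| EOne
| EAdd of expr & expr
| ESub of expr & expr
| EMul of expr & expr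
| EDiv of expr & expr
| ELe of expr & expr.

Inductive cmd : Type :=
| Assign of nat & expr
| Query of nat & expr
| Seq of cmd & cmd
| If of expr & cmd & cmd
| While of expr & cmd
| Call of nat & cmd & expr.

Fixpoint oracle_free (c : cmd) : bool :=
  match c with
  | Assign _ _ => true
  | Query _ _ => false
  | Seq c1 c2 => oracle_free c1 && oracle_free c2
  | If _ c1 c2 => oracle_free c1 && oracle_free c2
  | While _ c1 => oracle_free c1
  | Call _ c1 _ => oracle_free c1
  end.

Section Semantics.
Variable R : realFieldType.
Local Notation tree := (tree R).

Fixpoint tsize (v : tree) : nat :=
  if v is Node a b then (tsize a + tsize b).+1 else 1%N.

Definition enc_bool (b : bool) : tree := if b then Node Leaf Leaf else Leaf.
Definition enc_nat (k : nat) : tree := iter k (Node Leaf) Leaf.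
Definition enc_seq (s : seq tree) : tree := foldr (@Node R) Leaf s.
Definition enc_set (k : nat) (A : {set 'I_k}) : tree :=
  enc_seq [seq enc_bool (i \in A) | i <- enum 'I_k].

Definition truthy (v : tree) : bool := if v is Leaf then false else true.
Definition num_of (v : tree) : R := if v is Scalar r then r else 0.

Definition store : Type := nat -> tree.
Definition init (v : tree) : store := fun k => if k == 0%N then v else Leaf.
Definition update (s : store) (x : nat) (v : tree) : store :=
  fun k => if k == x then v else s k.

Fixpoint eval (s : store) (e : expr) : tree :=
  match e with
  | Var x => s x
  | ENil => Leaf
  | EPair e1 e2 => Node (eval s e1) (eval s e2)
  | EFst e1 => if eval s e1 is Node a _ then a else Leaf
  | ESnd e1 => if eval s e1 is Node _ b then b else Leaf
  | EIsNum e1 => enc_bool (if eval s e1 is Scalar _ then true else false)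
  | EZero => Scalar 0
  | EOne => Scalar 1
  | EAdd e1 e2 => Scalar (num_of (eval s e1) + num_of (eval s e2))
  | ESub e1 e2 => Scalar (num_of (eval s e1) - num_of (eval s e2))
  | EMul e1 e2 => Scalar (num_of (eval s e1) * num_of (eval s e2))
  | EDiv e1 e2 => Scalar (num_of (eval s e1) / num_of (eval s e2))
  | ELe e1 e2 => enc_bool (num_of (eval s e1) <= num_of (eval s e2))
  end.

(* [exec O c s t s']: with oracle O, the command c started in store s halts in
   store s' after t steps.  [Call x c e] runs c in a fresh store as a
   procedure: input and output are both passed in variable 0. *)
Inductive exec (O : tree -> tree) : cmd -> store -> nat -> store -> Prop :=
| ExecAssign x e s :
    exec O (Assign x e) s 1%N (update s x (eval s e))
| ExecQuery x e s :
    exec O (Query x e) s 1%N (update s x (O (eval s e)))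
| ExecSeq c1 c2 s t1 s1 t2 s2 :
    exec O c1 s t1 s1 -> exec O c2 s1 t2 s2 ->
    exec O (Seq c1 c2) s (t1 + t2)%N s2
| ExecIfTrue e c1 c2 s t s' :
    truthy (eval s e) -> exec O c1 s t s' -> exec O (If e c1 c2) s t.+1 s'
| ExecIfFalse e c1 c2 s t s' :
    ~~ truthy (eval s e) -> exec O c2 s t s' -> exec O (If e c1 c2) s t.+1 s'
| ExecWhileTrue e c s t1 s1 t2 s2 :
    truthy (eval s e) -> exec O c s t1 s1 -> exec O (While e c) s1 t2 s2 ->
    exec O (While e c) s (t1 + t2).+1%N s2
| ExecWhileFalse e c s :
    ~~ truthy (eval s e) -> exec O (While e c) s 1%N s
| ExecCall x c e s t s' :
    exec O c (init (eval s e)) t s' ->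
    exec O (Call x c e) s t.+1 (update s x (s' 0%N)).

Definition runs_within (O : tree -> tree) (P : cmd) (input output : tree)
    (bound : nat) : Prop :=
  exists t s, [/\ exec O P (init input) t s, s 0%N = output & (t <= bound)%N].

Definition no_oracle : tree -> tree := fun _ => Leaf.

End Semantics.

(* Up to enlarging d, every polynomial in s is dominated by [poly_bound d s]. *)
Definition poly_bound (d s : nat) : nat := (d * s.+1 ^ d)%N.

Record covering (R : realFieldType) (m n : nat) := Covering {
  ecost : 'I_m -> R;
  req : 'I_n -> {set {set 'I_m}};
  ecost_ge0 : forall e, 0 <= ecost e;
  req_up : forall i (F G : {set 'I_m}), F \subset G -> F \in req i -> G \in req i
}.

Section Covering.
Variables (R : realFieldType) (m n : nat) (C : covering R m n).

Definition cost (F : {set 'I_m}) : R := \sum_(e in F) ecost C e.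

Definition satisfies (F : {set 'I_m}) (X : {set 'I_n}) : bool :=
  [forall i in X, F \in req C i].

(* The neutral element [cost setT] is never smaller than the cost of a feasible
   set, so this is the minimum as soon as one exists; likewise for
   [robust_opt]. *)
Definition opt_aug (X : {set 'I_n}) (S : {set 'I_m}) : R :=
  \big[Num.min/cost setT]_(A : {set 'I_m} | satisfies (S :|: A) X) cost A.

Definition opt (X : {set 'I_n}) : R := opt_aug X set0.

Section Robust.
Variables (Sigma : {set {set 'I_n}}) (lambda : R).

Definition robust_solution : Type :=
  ({set 'I_m} * {ffun {set 'I_n} -> {set 'I_m}})%type.

Definition robust_feasible (sol : robust_solution) : bool :=
  [forall w in Sigma, satisfies (sol.1 :|: sol.2 w) w].

Definition robust_obj (sol : robust_solution) : R :=
  cost sol.1 + lambda * \big[Num.max/0]_(w in Sigma) cost (sol.2 w).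

Definition robust_opt : R :=
  \big[Num.min/cost setT]_(sol : robust_solution | robust_feasible sol)
     robust_obj sol.

End Robust.
End Covering.

Definition p_system (R : realFieldType) (n : nat) (p : R)
    (M : {set {set 'I_n}}) : Prop :=
  (forall A B : {set 'I_n}, A \subset B -> B \in M -> A \in M) /\
  (forall A I J : {set 'I_n},
     maxset [pred B : {set 'I_n} | (B \in M) && (B \subset A)] I ->
     maxset [pred B : {set 'I_n} | (B \in M) && (B \subset A)] J ->
     #|I|%:R <= p * #|J|%:R).

(* A covering problem in the algorithmic sense (Steiner tree, set cover, ...):
   a family of instances.  The requirements of an instance need not be listed
   explicitly; they are conveyed to algorithms by the input data [descr x]. *)
Record covering_family (R : realFieldType) := CoveringFamily {
  inst : Type;
  nelts : inst -> nat;
  nreqs : inst -> nat;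
  problem : forall x, covering R (nelts x) (nreqs x);
  descr : inst -> tree R
}.

Section Algorithms.
Variables (R : realFieldType) (C : covering_family R).

Definition enc_inst (x : inst C) : tree R :=
  Node (enc_nat R (nelts x))
    (Node (enc_nat R (nreqs x))
      (Node (enc_seq [seq Scalar (ecost (problem x) e) | e <- enum 'I_(nelts x)])
        (descr x))).

Definition enc_aug (x : inst C) (S : {set 'I_(nelts x)})
    (X : {set 'I_(nreqs x)}) : tree R :=
  Node (enc_inst x) (Node (enc_set R S) (enc_set R X)).

Definition offline_algorithm (alpha : inst C -> R) (P : cmd) : Prop :=
  oracle_free P /\
  exists d : nat, forall (x : inst C) S X,
  exists A : {set 'I_(nelts x)},
    [/\ runs_within (@no_oracle R) P (enc_aug S X) (enc_set R A)
          (poly_bound d (tsize (enc_aug S X))),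
        satisfies (problem x) (S :|: A) X
      & cost (problem x) A <= alpha x * opt_aug (problem x) X S].

Definition enc_online (x : inst C) (sigma : seq 'I_(nreqs x)) : tree R :=
  Node (enc_inst x) (enc_seq [seq enc_nat R (nat_of_ord i) | i <- sigma]).

Definition online_algorithm (alpha : inst C -> R) (P : cmd) : Prop :=
  oracle_free P /\
  exists (d : nat) (Aon : forall x : inst C, seq 'I_(nreqs x) -> {set 'I_(nelts x)}),
  forall (x : inst C) (sigma : seq 'I_(nreqs x)),
    [/\ runs_within (@no_oracle R) P (enc_online sigma) (enc_set R (Aon x sigma))
          (poly_bound d (tsize (enc_online sigma))),
        satisfies (problem x) (Aon x sigma) [set i in sigma],
        forall i, Aon x sigma \subset Aon x (rcons sigma i)
      & cost (problem x) (Aon x sigma)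
          <= alpha x * opt (problem x) [set i in sigma]].

Definition membership_oracle (n L : nat) (Sigma : 'I_L -> {set {set 'I_n}})
    (O : tree R -> tree R) : Prop :=
  forall (j : 'I_L) (w : {set 'I_n}),
    O (Node (enc_nat R j) (enc_set R w)) = enc_bool R (w \in Sigma j).

Definition enc_robust (x : inst C) (lambda : R) (L : nat) : tree R :=
  Node (enc_inst x) (Node (Scalar lambda) (enc_nat R L)).

Definition enc_second (x : inst C) (lambda : R) (L : nat)
    (E0 : {set 'I_(nelts x)}) (w : {set 'I_(nreqs x)}) : tree R :=
  Node (enc_robust x lambda L) (Node (enc_set R E0) (enc_set R w)).

(* [P1] computes the first-stage set and [P2] is the augmentation procedure;
   both may query the membership oracles of the Sigma j.  The bound q on the
   number L of systems is fixed before the running time, which is polynomial in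
   the size of the covering instance alone.  [ratio x p] bounds the ratio on x
   for unions of p-systems. *)
Definition robust_algorithm (q : nat) (ratio : inst C -> R -> R)
    (P1 P2 : cmd) : Prop :=
  exists d : nat,
  forall (x : inst C) (lambda : R) (L : nat)
         (Sigma : 'I_L -> {set {set 'I_(nreqs x)}}) (p : R) (O : tree R -> tree R),
    1 <= lambda ->
    (L <= poly_bound q (nreqs x))%N ->
    (forall j, p_system p (Sigma j)) ->
    membership_oracle Sigma O ->
    let U := \bigcup_j Sigma j in
    exists sol : robust_solution (nelts x) (nreqs x),
      [/\ runs_within O P1 (enc_robust x lambda L) (enc_set R sol.1)
            (poly_bound d (tsize (enc_inst x))),
          forall w, w \in U ->
            runs_within O P2 (enc_second lambda L sol.1 w) (enc_set R (sol.2 w))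
              (poly_bound d (tsize (enc_inst x))),
          robust_feasible (problem x) U sol
        & robust_obj (problem x) U lambda sol
            <= ratio x p * robust_opt (problem x) U lambda].

End Algorithms.

(* Main.v *)
(* The algorithm.  Starting from the requests [rs] fed to the online algorithm
   so far, a round runs, for each p-system separately, the greedy algorithm that
   repeatedly feeds the admissible requirement for which the online cost
   becomes largest, and keeps the p-system with the largest total increase
   [D].  As in the greedy analysis for p-systems, every scenario can then be
   covered from the current online solution at cost at most [(p + 1) D].  The
   online cost never decreases and grows strictly in a round with [D > 0], so
   among [m + 1] rounds one has [D = 0].  The first stage is the online solution
   before the round that minimizes (its cost) + lambda [D]; neither [p] nor the
   approximation ratios need to be known.

   Its quality.  Let an arbitrary robust solution have first-stage cost [Phi]
   and worst second-stage cost [T], and let [k] rounds have increased the online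
   cost by more than [2 alpha_on T] each.  The requests then have a cover of
   cost [Phi + k T], so [2 alpha_on k T <= cost <= alpha_on (Phi + k T)] and thus
   [cost <= 2 alpha_on Phi].  Hence the first round with
   [D <= 2 alpha_on T] has value at most [2 alpha_on (Phi + lambda T)]. *)

Require Import Defs.
From mathcomp Require Import all_boot all_order all_algebra.
From mathcomp Require Import zify ring lra.

Set Implicit Arguments.
Unset Strict Implicit.
Unset Printing Implicit Defensive.

Import Order.TTheory GRing.Theory Num.Theory.
Local Open Scope ring_scope.

Lemma set_cons (T : finType) (x : T) (s : seq T) :
  [set y in x :: s] = x |: [set y in s].
Proof. by apply/setP => y; rewrite !inE. Qed.

(** * Costs and optima of covering problems *)

Section CoveringFacts.
Variables (R : realFieldType) (m n : nat) (C : covering R m n).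

Lemma cost_ge0 (F : {set 'I_m}) : 0 <= cost C F.
Proof. by apply: sumr_ge0 => e _; apply: ecost_ge0. Qed.

Lemma cost_set0 : cost C set0 = 0.
Proof. by rewrite /cost big_set0. Qed.

Lemma cost_mono (F G : {set 'I_m}) : F \subset G -> cost C F <= cost C G.
Proof.
move=> sFG; rewrite /cost [leRHS](big_setID F) /= (setIidPr sFG) lerDl.
by apply: sumr_ge0 => e _; apply: ecost_ge0.
Qed.

Lemma cost_setD (F G : {set 'I_m}) :
  F \subset G -> cost C (G :\: F) = cost C G - cost C F.
Proof.
move=> sFG; rewrite /cost [X in _ = X - _](big_setID F) /= (setIidPr sFG).
by rewrite [X in _ = X - _]addrC addrK.
Qed.

Lemma cost_setU (F G : {set 'I_m}) : cost C (F :|: G) <= cost C F + cost C G.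
Proof.
have -> : F :|: G = F :|: (G :\: F) by rewrite setDE setUIr setUCr setIT.
have -> : cost C (F :|: G :\: F) = cost C F + cost C (G :\: F).
  by rewrite /cost (big_setID F) /= setUK setDUl setDv set0U setDDl setUid.
by rewrite lerD2l cost_mono // subsetDl.
Qed.

Lemma cost_bigcup (I : finType) (D : {set I}) (Z : I -> {set 'I_m}) :
  cost C (\bigcup_(i in D) Z i) <= \sum_(i in D) cost C (Z i).
Proof.
elim/big_rec2: _ => [|i y F _ le_F_y]; first by rewrite cost_set0.
by apply: le_trans (cost_setU _ _) _; rewrite lerD2l.
Qed.

Lemma satisfiesP (F : {set 'I_m}) (X : {set 'I_n}) :
  reflect (forall i, i \in X -> F \in req C i) (satisfies C F X).
Proof. exact: forall_inP. Qed.

Lemma satisfies_mono (F G : {set 'I_m}) (X Y : {set 'I_n}) :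
  F \subset G -> Y \subset X -> satisfies C F X -> satisfies C G Y.
Proof.
move=> sFG /subsetP sYX /satisfiesP satF; apply/satisfiesP => i /sYX /satF.
exact: req_up.
Qed.

Lemma opt_aug_le (X : {set 'I_n}) (S A : {set 'I_m}) :
  satisfies C (S :|: A) X -> opt_aug C X S <= cost C A.
Proof. by move=> satA; apply: (bigmin_le_cond _ (cost C)). Qed.

Lemma opt_aug_ge0 (X : {set 'I_n}) (S : {set 'I_m}) : 0 <= opt_aug C X S.
Proof. by apply: le_bigmin => *; apply: cost_ge0. Qed.

Lemma opt_aug_set0 (S : {set 'I_m}) : opt_aug C set0 S = 0.
Proof.
apply/eqP; rewrite eq_le opt_aug_ge0 andbT -cost_set0; apply: opt_aug_le.
by apply/satisfiesP => i; rewrite inE.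
Qed.

Lemma opt_aug_mono (X Y : {set 'I_n}) (S T : {set 'I_m}) :
  X \subset Y -> S \subset T -> opt_aug C X T <= opt_aug C Y S.
Proof.
move=> sXY sST; apply: le_bigmin => [|A satA]; first exact: bigmin_le_id.
by apply: opt_aug_le; apply: satisfies_mono satA; rewrite ?setSU.
Qed.

End CoveringFacts.

(** * The greedy algorithm on a p-system *)

Section Greedy.
Variables (R : realFieldType) (m n : nat) (C : covering R m n).

(* [A rs] is the online solution after the requirements of [rs] have arrived,
   the head of [rs] being the most recent one. *)
Variable A : seq 'I_n -> {set 'I_m}.
Hypothesis A_sat : forall rs, satisfies C (A rs) [set i in rs].
Hypothesis A_mono : forall i rs, A rs \subset A (i :: rs).

Local Notation f rs := (cost C (A rs)).

Lemma online_cat (r rs : seq 'I_n) : A rs \subset A (r ++ rs).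
Proof. by elim: r => //= i r IH; apply: subset_trans IH _. Qed.

Lemma online_req (i : 'I_n) (rs : seq 'I_n) : i \in rs -> A rs \in req C i.
Proof. by move=> rs_i; move/satisfiesP: (A_sat rs); apply; rewrite inE. Qed.

Definition candidate (M : {set {set 'I_n}}) (W : {set 'I_n}) (i : 'I_n) : bool :=
  (i \notin W) && (i |: W \in M).

Definition greedy_pick (M : {set {set 'I_n}}) (W : {set 'I_n})
    (rs : seq 'I_n) (i : 'I_n) : Prop :=
  candidate M W i /\
  forall i', candidate M W i' -> f (i' :: rs) <= f (i :: rs).

(** The latest pick comes first, so that [r ++ rs] is the request list reached after the run [r]. *)
Fixpoint greedy_chain (M : {set {set 'I_n}}) (rs r : seq 'I_n) : Prop :=
  if r is i :: r' then
    greedy_chain M rs r' /\ greedy_pick M [set i in r'] (r' ++ rs) i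
  else True.

Definition greedy_maximal (M : {set {set 'I_n}}) (rs r : seq 'I_n) : Prop :=
  greedy_chain M rs r /\ forall i, ~~ candidate M [set i in r] i.

Lemma greedy_chain_uniq M rs r : greedy_chain M rs r -> uniq r.
Proof.
by elim: r => //= i r IH [/IH -> [/andP[]]]; rewrite inE => ->.
Qed.

Lemma greedy_chain_size M rs r : greedy_chain M rs r -> (size r <= n)%N.
Proof.
move=> /greedy_chain_uniq /card_uniqP <-.
by rewrite -[leqRHS]card_ord max_card.
Qed.

(** The empty run is kept apart because [M] may be the empty family. *)
Lemma greedy_chain_mem M rs r :
  greedy_chain M rs r -> r = [::] \/ [set i in r] \in M.
Proof.
by case: r => [|i r] /=; [left | right; rewrite set_cons; case: H => _ [/andP[]]].
Qed.

Section Bound.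
Variables (M : {set {set 'I_n}}) (p : R) (rs : seq 'I_n) (w : {set 'I_n}).
Hypothesis Mp : p_system p M.
Hypothesis Mw : w \in M.

(** In matroid terms, the part of [w] outside [W] that is spanned by [W]. *)
Definition blocked (W : {set 'I_n}) : {set 'I_n} :=
  [set e in w | (e \notin W) && (e |: W \notin M)].

(** A nonempty maximal member is compared with itself. *)
Lemma p_system_ge1 (W : {set 'I_n}) : W \in M -> W != set0 -> 1 <= p.
Proof.
move=> MW W0; have [down psys] := Mp.
have [|I maxI sWI] := @maxset_exists _ [pred B | (B \in M) && (B \subset setT)] W.
  by rewrite /= MW subsetT.
have I_gt0 : (0 < #|I|)%N.
  by apply: leq_trans (subset_leq_card sWI); rewrite card_gt0.
have := psys _ _ _ maxI maxI.
by rewrite -[X in X <= _]mul1r ler_pM2r // ltr0n.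
Qed.

(** Inside [W :|: blocked W] the set [W] is maximal, while [blocked W] is a member, being a subset
    of [w]. Extending the latter to a maximal member makes the two sizes comparable. *)
Lemma card_blocked (W : {set 'I_n}) : W \in M -> #|blocked W|%:R <= p * #|W|%:R.
Proof.
move=> MW; have [down psys] := Mp.
have MD : blocked W \in M by apply: down Mw; apply/subsetP => e; rewrite inE => /andP[].
set Q := [pred B : {set 'I_n} | (B \in M) && (B \subset W :|: blocked W)].
have [|I maxI sDI] := @maxset_exists _ Q (blocked W).
  by rewrite /= MD subsetUr.
apply: le_trans (psys _ _ _ maxI _); first by rewrite ler_nat subset_leq_card.
apply/maxsetP; split; first by rewrite /= MW subsetUl.
move=> B /andP[MB sB] sWB; apply/eqP; rewrite eqEsubset sWB andbT.
apply/subsetP => e Be; have := subsetP sB e Be; rewrite !inE => /orP[//|/and3P[_ _]].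
case/negP; apply: down MB; by rewrite subUset sub1set Be.
Qed.

(* Abel summation by induction on the run: [g] is the smallest increment so
   far, which bounds the price of covering any element not yet blocked.  The
   slack [p |r| - #|blocked r|] is kept at price [g] to pay for elements that
   get blocked later. *)
Lemma greedy_invariant (r : seq 'I_n) : greedy_chain M rs r ->
  exists g : R, exists B : {set 'I_m},
    [/\ 0 <= g,
        forall e, e \in w -> candidate M [set i in r] e ->
          exists Z, A (r ++ rs) :|: Z \in req C e /\ cost C Z <= g,
        satisfies C (A (r ++ rs) :|: B) (blocked [set i in r])
      & cost C B + (p * (size r)%:R - #|blocked [set i in r]|%:R) * g
          <= p * (f (r ++ rs) - f rs)].
Proof.
have [down _] := Mp.
elim: r => [_|i r IH [chain [cand_i max_i]]] /=.
  have D0 : blocked [set i in [::]] = set0.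
    apply/setP => e; rewrite !inE; apply/negbTE/negP => /and3P[we _ /negP[]].
    apply: down Mw; rewrite subUset sub1set we.
    by apply/subsetP => x; rewrite !inE.
  (* Before any increment the whole ground set serves as the price, since no cover costs more. *)
  exists (cost C setT), set0; split.
  - exact: cost_ge0.
  - move=> e we _; exists (A [:: e]); split; last by rewrite cost_mono ?subsetT.
    by apply: req_up (subsetUr _ _) _; apply: online_req; rewrite inE.
  - by rewrite D0; apply/satisfiesP => e; rewrite inE.
  - by rewrite D0 cost_set0 cards0 mulr0 !subrr mul0r mulr0 addr0.
have [g [B [g0 unbl satB costB]]] := IH chain.
have Mir : i |: [set x in r] \in M by case/andP: cand_i.
have i_r : i \notin r by case/andP: cand_i; rewrite inE.
have p0 : 0 <= p.
  apply: le_trans (p_system_ge1 Mir _); first exact: ler01.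
  by apply/set0Pn; exists i; rewrite setU11.
set W := [set x in r] in unbl satB costB Mir cand_i max_i *.
have MW : W \in M by apply: down Mir; apply: subsetUr.
rewrite set_cons -/W; set rs' := r ++ rs in unbl satB costB max_i *.
pose inc := f (i :: rs') - f rs'; pose g' := Num.min g inc.
have inc0 : 0 <= inc by rewrite subr_ge0 cost_mono.
have g'0 : 0 <= g' by rewrite /g' le_min g0 inc0.
have candS e : candidate M (i |: W) e -> candidate M W e.
  rewrite /candidate !inE negb_or => /andP[/andP[_ ->] /down]; apply.
  by rewrite setUS ?subsetUr.
have cover e : e \in w -> candidate M W e ->
    exists Z, A (i :: rs') :|: Z \in req C e /\ cost C Z <= g'.
  move=> we cand_e; have [Z [satZ costZ]] := unbl e we cand_e.
  rewrite /g'; case: leP => _.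
    by exists Z; split=> //; apply: req_up satZ; apply: setSU.
  (* [e] was a candidate when the greedy rule took [i], so what the online algorithm would have
     bought for [e] costs at most [inc]. *)
  exists (A (e :: rs') :\: A rs'); split.
    apply: req_up (_ : A (e :: rs') \in _); last by rewrite online_req ?inE ?eqxx.
    apply/subsetP => x xe; rewrite !inE xe andbT.
    by case: (boolP (x \in A rs')) => [/(subsetP (A_mono i rs')) ->|_]; rewrite ?orbT.
  by rewrite cost_setD // lerD2r max_i.
have sD : blocked W \subset blocked (i |: W).
  apply/subsetP => e; rewrite !inE => /and3P[-> e_r eW] /=.
  rewrite negb_or e_r andbT; apply/andP; split.
    by apply: contraNneq eW => ->.
  by apply: contra eW; apply: down; rewrite setUS ?subsetUr.
(* The newly blocked elements were still candidates before [i] was added, so each can be covered at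
   price [g']. *)
pose N := blocked (i |: W) :\: blocked W.
have candN e : e \in N -> e \in w /\ candidate M W e.
  rewrite !inE negb_or => /andP[+ /and3P[we /andP[_ eW] _]].
  by rewrite we eW /= negbK /candidate inE eW.
have [Z ZP] : exists Z : 'I_n -> {set 'I_m}, forall e, e \in N ->
    A (i :: rs') :|: Z e \in req C e /\ cost C (Z e) <= g'.
  apply: (@fin_all_exists _ (fun=> {set 'I_m}) (fun e Z => e \in N ->
    A (i :: rs') :|: Z \in req C e /\ cost C Z <= g')) => e.
  case: (boolP (e \in N)) => [/candN[we cand_e]|_]; last by exists set0.
  by have [Z ZP] := cover e we cand_e; exists Z.
exists g', (B :|: \bigcup_(e in N) Z e); split=> //.
- by move=> e we /candS; apply: cover.
- apply/satisfiesP => e De; case: (boolP (e \in N)) => Ne.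
    apply: req_up (proj1 (ZP e Ne)); apply: setUS.
    by apply: subset_trans (subsetUr _ _); apply: bigcup_sup.
  have : e \in blocked W by move: Ne; rewrite inE De andbT negbK.
  move/(satisfiesP _ _ _ satB); apply: req_up; apply: setUSS => //.
  exact: subsetUl.
have costN : cost C (\bigcup_(e in N) Z e) <= #|N|%:R * g'.
  apply: le_trans (cost_bigcup _ _ _) _.
  rewrite mulr_natl -sumr_const; apply: ler_sum => e Ne.
  by case: (ZP e Ne).
have cardN : #|blocked (i |: W)|%:R = #|blocked W|%:R + #|N|%:R :> R.
  by rewrite -natrD -(cardsID (blocked W) (blocked (i |: W))) (setIidPr sD).
have costU := cost_setU C B (\bigcup_(e in N) Z e).
(* As the slack is nonnegative, lowering the price from [g] to [g'] only shrinks its value. The pick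
   [i] adds [p] units of slack, paid for by [p * inc]. *)
have slack : 0 <= p * (size r)%:R - #|blocked W|%:R.
  rewrite subr_ge0; apply: le_trans (card_blocked MW) _.
  by rewrite ler_wpM2l // ler_nat cardsE card_size.
have h1 : (p * (size r)%:R - #|blocked W|%:R) * g' <=
          (p * (size r)%:R - #|blocked W|%:R) * g.
  by rewrite ler_wpM2l // ge_min lexx.
have h2 : p * g' <= p * inc by rewrite ler_wpM2l // ge_min lexx orbT.
rewrite /inc in h2; rewrite cardN -natr1.
move: costU costN h1 h2 costB.
rewrite !(mulrBl, mulrBr, mulrDl, mulrDr, mulr1); lra.
Qed.

(** After a maximal run every element of [w] has been requested or is blocked. The online increment
    covers the former at one gain, and the set [B] of the invariant covers the latter at [p]
    gains. *)
Lemma greedy_opt_aug (r : seq 'I_n) : greedy_maximal M rs r ->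
  opt_aug C w (A rs) <= (p + 1) * (f (r ++ rs) - f rs).
Proof.
move=> [chain maxr]; have [down _] := Mp.
have [g [B [g0 _ satB costB]]] := greedy_invariant chain.
set W := [set i in r] in satB costB maxr.
have MW : W \in M.
  case: (greedy_chain_mem chain) => // r0; apply: down Mw.
  by apply/subsetP => x; rewrite /W r0 !inE.
have slack : 0 <= (p * (size r)%:R - #|blocked W|%:R) * g.
  apply: mulr_ge0 => //; rewrite subr_ge0; apply: le_trans (card_blocked MW) _.
  by rewrite cardsE (card_uniqP (greedy_chain_uniq chain)).
have satw : satisfies C (A rs :|: ((A (r ++ rs) :\: A rs) :|: B)) w.
  have -> : A rs :|: (A (r ++ rs) :\: A rs :|: B) = A (r ++ rs) :|: B.
    by rewrite setUA setDE setUIr setUCr setIT (setUidPr (online_cat r rs)).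
  apply/satisfiesP => e we; case: (boolP (e \in r)) => re.
    by apply: req_up (subsetUl _ _) _; apply: online_req; rewrite mem_cat re.
  apply: (satisfiesP _ _ _ satB); rewrite !inE we re /=.
  by have := maxr e; rewrite /candidate inE re.
apply: le_trans (opt_aug_le satw) _.
apply: le_trans (cost_setU _ _ _) _.
rewrite (cost_setD _ (online_cat r rs)) mulrDl mul1r addrC lerD2r.
by apply: le_trans costB; rewrite lerDl.
Qed.

End Bound.
End Greedy.

(** * The approximation ratio *)

Section Rounds.
Variables (R : realFieldType) (m n : nat) (C : covering R m n).
Variable A : seq 'I_n -> {set 'I_m}.
Hypothesis A_sat : forall rs, satisfies C (A rs) [set i in rs].
Hypothesis A_mono : forall i rs, A rs \subset A (i :: rs).
Variables (U : {set {set 'I_n}}) (lambda alpha p : R).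
Hypothesis lambda1 : 1 <= lambda.
Hypothesis A_comp : forall rs, cost C (A rs) <= alpha * opt C [set i in rs].

Local Notation f rs := (cost C (A rs)).

Definition augmentable (E0 : {set 'I_m}) (D : R) : Prop :=
  forall w, w \in U -> opt_aug C w E0 <= (p + 1) * D.

(** The requests added by a round, if any, form one scenario, so a single second stage of the
    compared solution covers them. *)
Definition round_step (rs rs' : seq 'I_n) : Prop :=
  (exists r, [/\ rs' = r ++ rs, (size r <= n)%N & r = [::] \/ [set i in r] \in U]) /\
  augmentable (A rs) (f rs' - f rs).

Definition certified (E0 : {set 'I_m}) (v : R) : Prop :=
  exists rs D, [/\ E0 = A rs, 0 <= D, v = f rs + lambda * D & augmentable E0 D].

Lemma round_step_certified rs rs' : round_step rs rs' ->
  certified (A rs) (f rs + lambda * (f rs' - f rs)).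
Proof.
move=> [[r [-> _ _]] aug]; exists rs, (f (r ++ rs) - f rs); split=> //.
by rewrite subr_ge0 cost_mono ?(online_cat A_mono).
Qed.

Section Compare.
Variable sol : robust_solution m n.
Hypothesis feas : robust_feasible C U sol.

Let Phi := cost C sol.1.
Let T := \big[Num.max/0]_(w in U) cost C (sol.2 w).

(* State after [k] rounds that all gained more than [2 alpha T].  Such rounds
   cannot go on: the adversary sequence costs the optimum at most [Phi + k T]. *)
Definition expensive_rounds (k : nat) (rs : seq 'I_n) : Prop :=
  [/\ (k <= #|A rs|)%N, 2 * alpha * (k%:R * T) <= f rs
    & exists Z : {set 'I_m}, [/\ sol.1 \subset Z, cost C Z <= Phi + k%:R * T
                               & satisfies C Z [set i in rs]]].

Lemma second_stage_ge0 : 0 <= T.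
Proof. exact: bigmax_ge_id. Qed.

Lemma expensive_rounds0 : expensive_rounds 0 [::].
Proof.
split=> //; first by rewrite mul0r mulr0 cost_ge0.
exists sol.1; split; rewrite ?mul0r ?addr0 //.
by apply/satisfiesP => i; rewrite inE.
Qed.

Lemma expensive_rounds_step (k : nat) (rs rs' : seq 'I_n) :
  0 <= alpha -> expensive_rounds k rs -> round_step rs rs' ->
  f rs + lambda * (f rs' - f rs) <= 2 * alpha * robust_obj C U lambda sol \/
  expensive_rounds k.+1 rs'.
Proof.
move=> alpha0 [card_k cost_k [Z [sZ costZ satZ]]] [[r [-> _ Ur]] _].
have T0 := second_stage_ge0.
have fPhi : f rs <= alpha * (Phi + k%:R * T).
  apply: le_trans (A_comp rs) _; apply: ler_wpM2l => //.
  by apply: le_trans costZ; apply: opt_aug_le; rewrite set0U.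
have sub := online_cat A_mono r rs.
case: (leP (f (r ++ rs) - f rs) (2 * alpha * T)) => [small|big]; [left|right].
  (* Together [fPhi] and [cost_k] eliminate [k%:R * T] and leave [f rs <= 2 * alpha * Phi]. *)
  have h : lambda * (f (r ++ rs) - f rs) <= lambda * (2 * alpha * T).
    by rewrite ler_wpM2l // (le_trans ler01).
  rewrite /robust_obj -/Phi -/T.
  by move: h fPhi cost_k; rewrite !mulrDr; lra.
have aT : 0 <= 2 * alpha * T by rewrite !mulr_ge0.
split.
(* A gain above a nonnegative threshold is positive, so the online solution acquires a new element;
   this is what limits the number of such rounds. *)
- apply: leq_ltn_trans card_k _; apply: proper_card.
  rewrite properEneq sub andbT; apply: contraTneq big => ->.
  by rewrite subrr -leNgt.
- by move: big cost_k; rewrite -[k.+1%:R]natr1 (mulrDl _ _ T) mul1r mulrDr; lra.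
case: Ur => [->|Ur].
  exists Z; split=> //; apply: le_trans costZ _.
  by rewrite lerD2l ler_wpM2r // ler_nat.
exists (Z :|: sol.2 [set i in r]); split.
- by apply: subset_trans (subsetUl _ _).
- apply: le_trans (cost_setU _ _ _) _.
  rewrite -natr1 mulrDl mul1r addrA lerD //.
  exact: (le_bigmax_cond _ (fun w => cost C (sol.2 w))).
apply/satisfiesP => i; rewrite inE mem_cat => /orP[ri|rsi].
  have := forall_inP feas _ Ur; move/satisfiesP/(_ i); rewrite inE => /(_ ri).
  by apply: req_up; apply: setSU.
by apply: req_up (subsetUl _ _) _; apply: (satisfiesP _ _ _ satZ); rewrite inE.
Qed.

Lemma expensive_rounds_bound (k : nat) (rs : seq 'I_n) :
  expensive_rounds k rs -> (k <= m)%N.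
Proof.
by move=> [/leq_trans le_k _ _]; apply: le_k; rewrite -[leqRHS]card_ord max_card.
Qed.

End Compare.

Variables (alpha_off : R) (E : {ffun {set 'I_n} -> {set 'I_m}}).
Hypothesis offline : forall S X, exists B,
  satisfies C (S :|: B) X /\ cost C B <= alpha_off * opt_aug C X S.
Hypothesis p_ge1 : forall w, w \in U -> w != set0 -> 1 <= p.

(** In the main case the factor [(p + 1) * alpha_off], caused by the second stage, is at least 1 and
    may multiply the first stage too. Two degenerate cases are separate: if covering everything is
    free, the ratios have no lower bound, and without a nonempty scenario [p] is arbitrary. *)
Lemma certified_ratio (E0 : {set 'I_m}) (v : R) :
  certified E0 v ->
  (0 <= alpha -> forall sol, robust_feasible C U sol ->
     v <= 2 * alpha * robust_obj C U lambda sol) ->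
  (forall w, cost C (E w) <= alpha_off * opt_aug C w E0) ->
  robust_obj C U lambda (E0, E) <=
    2 * ((p + 1) * alpha_off * alpha) * robust_opt C U lambda.
Proof.
move=> [rs [D [-> D0 -> aug]]] best costE.
have lambda0 : 0 <= lambda by apply: le_trans lambda1; apply: ler01.
have optT rs' : opt C [set i in rs'] <= opt C setT.
  by apply: opt_aug_mono; rewrite ?subsetT.
have satT : satisfies C (A (enum 'I_n)) setT.
  apply: satisfies_mono (A_sat (enum 'I_n)) => //.
  by apply/subsetP => i _; rewrite inE mem_enum.
have obj_le t : 0 <= t -> (forall w, w \in U -> cost C (E w) <= t) ->
    robust_obj C U lambda (A rs, E) <= f rs + lambda * t.
  move=> t0 ht; rewrite /robust_obj lerD2l ler_wpM2l //.
  by apply/bigmax_leP.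
have obj_ge0 sol : 0 <= robust_obj C U lambda sol.
  by rewrite addr_ge0 ?cost_ge0 // mulr_ge0 // second_stage_ge0.
have opt_ge0 : 0 <= robust_opt C U lambda.
  by apply: le_bigmin => [|sol _]; rewrite ?cost_ge0 ?obj_ge0.
have opt_eq0 F : satisfies C F (\bigcup_(w in U) w) -> cost C F = 0 ->
    robust_opt C U lambda = 0.
  move=> satF F0; apply/eqP; rewrite eq_le opt_ge0 andbT.
  have feasF : robust_feasible C U (F, [ffun=> set0]).
    apply/forall_inP => w Uw /=; apply: satisfies_mono satF; first exact: subsetUl.
    exact: bigcup_sup.
  apply: le_trans (bigmin_le_cond _ (robust_obj C U lambda) feasF) _.
  rewrite /robust_obj /= F0 add0r mulr_ge0_le0 //.
  by apply/bigmax_leP; split=> // w _; rewrite ffunE cost_set0.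
have [opt0|opt_neq0] := eqVneq (opt C setT) 0.
  have f0 rs' : f rs' = 0.
    apply/eqP; rewrite eq_le cost_ge0 andbT; apply: le_trans (A_comp _) _.
    suff -> : opt C [set i in rs'] = 0 by rewrite mulr0.
    by apply/eqP; rewrite eq_le opt_aug_ge0 -opt0 optT.
  rewrite (opt_eq0 (A (enum 'I_n))) //; last first.
    by apply: satisfies_mono satT; rewrite ?subsetT.
  rewrite mulr0; apply: le_trans (obj_le 0 (lexx _) _) _; last by rewrite f0 mulr0 addr0.
  move=> w _; apply: le_trans (costE w) _.
  suff -> : opt_aug C w (A rs) = 0 by rewrite mulr0.
  by apply/eqP; rewrite eq_le opt_aug_ge0 -[leRHS]opt0 opt_aug_mono ?sub0set ?subsetT.
have opt_gt0 : 0 < opt C setT by rewrite lt_def opt_neq0 opt_aug_ge0.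
(* The online solution for all requirements is itself a cover, so its cost lies between the positive
   optimum and [alpha] times it. *)
have alpha1 : 1 <= alpha.
  have := le_trans (opt_aug_le (_ : satisfies C (set0 :|: A (enum 'I_n)) setT))
                   (A_comp (enum 'I_n)).
  have -> : [set i in enum 'I_n] = setT by apply/setP => i; rewrite !inE mem_enum.
  by rewrite set0U -/(opt C setT) -[X in X <= _]mul1r ler_pM2r //; apply.
have alpha_off1 : 1 <= alpha_off.
  have [B [satB costB]] := offline set0 setT.
  have := le_trans (opt_aug_le satB) costB.
  by rewrite -/(opt C setT) -[X in X <= _]mul1r ler_pM2r.
have alpha0 : 0 <= alpha by apply: le_trans alpha1; apply: ler01.
have alpha_off0 : 0 <= alpha_off by apply: le_trans alpha_off1; apply: ler01.
have {}best := best alpha0.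
have [/existsP[w /andP[Uw w0]]|/existsPn triv] :=
  boolP [exists w, (w \in U) && (w != set0)].
  have p1 := p_ge1 Uw w0.
  have pD0 : 0 <= (p + 1) * D by apply: mulr_ge0 => //; lra.
  have c1 : 1 <= (p + 1) * alpha_off.
    by apply: mulr_ege1 => //; lra.
  have bound sol : robust_feasible C U sol ->
      robust_obj C U lambda (A rs, E) <=
      2 * ((p + 1) * alpha_off * alpha) * robust_obj C U lambda sol.
    move=> /best le_v.
    apply: le_trans (obj_le (alpha_off * ((p + 1) * D)) _ _) _.
    - exact: mulr_ge0.
    - by move=> w' Uw'; apply: le_trans (costE w') _; rewrite ler_wpM2l // aug.
    apply: (@le_trans _ _ (((p + 1) * alpha_off) * (f rs + lambda * D))).
      have -> : lambda * (alpha_off * ((p + 1) * D)) =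
         ((p + 1) * alpha_off) * (lambda * D) by ring.
      by rewrite mulrDr lerD2r ler_peMl ?cost_ge0.
    have -> : 2 * ((p + 1) * alpha_off * alpha) * robust_obj C U lambda sol =
       ((p + 1) * alpha_off) * (2 * alpha * robust_obj C U lambda sol) by ring.
    by rewrite ler_wpM2l // (le_trans ler01 c1).
  have K0 : 0 <= 2 * ((p + 1) * alpha_off * alpha).
    by rewrite !mulr_ge0 //; lra.
  (* The minimum also ranges over its neutral element [cost C setT]; buying everything in the first
     stage is feasible and has at most this value. *)
  rewrite /robust_opt; elim/big_rec: _ => [|sol x feas_sol IH].
    have feasT : robust_feasible C U (setT, [ffun=> set0]).
      apply/forall_inP => w' _ /=.
      by apply: satisfies_mono satT; rewrite ?subsetT // setTU subsetT.
    apply: le_trans (bound _ feasT) _; rewrite ler_wpM2l //.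
    rewrite /robust_obj /= gerDl mulr_ge0_le0 //.
    by apply/bigmax_leP; split=> // w' _; rewrite ffunE cost_set0.
  by rewrite minElt; case: ifP => _; [exact: bound | exact: IH].
have U0 w : w \in U -> w = set0.
  by move=> Uw; have := triv w; rewrite Uw /= negbK => /eqP.
have sat0 : satisfies C set0 (\bigcup_(w in U) w).
  by apply/satisfiesP => i /bigcupP[w /U0 ->]; rewrite inE.
rewrite (opt_eq0 _ sat0 (cost_set0 C)) mulr0.
have feas0 : robust_feasible C U (set0, [ffun=> set0]).
  by apply/forall_inP => w /U0 ->; apply/satisfiesP => i; rewrite inE.
have obj0 : robust_obj C U lambda (set0, [ffun=> set0]) <= 0.
  rewrite /robust_obj /= cost_set0 add0r mulr_ge0_le0 //.
  by apply/bigmax_leP; split=> // w' _; rewrite ffunE cost_set0.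
(* Comparison with the empty solution forces [v <= 0], hence a free first stage. *)
have := best _ feas0.
have lD0 : 0 <= lambda * D by apply: mulr_ge0.
have -> : robust_obj C U lambda (set0, [ffun=> set0]) = 0.
  by apply/eqP; rewrite eq_le obj0 obj_ge0.
rewrite mulr0 => le_v.
apply: le_trans (obj_le 0 (lexx _) _) _.
  by move=> w /U0 ->; apply: le_trans (costE _) _; rewrite opt_aug_set0 mulr0.
by move: (cost_ge0 C (A rs)); lra.
Qed.

End Rounds.

(** * Timed execution of commands *)

Section Language.
Variables (R : realFieldType) (O : tree R -> tree R).
Implicit Types (s : store R) (c : cmd) (v w : tree R).

(** This lets the given offline and online programs, which are analysed without an oracle, run
    inside programs that have one. *)
Lemma exec_oracle_free c s t s' :
  oracle_free c -> exec (@no_oracle R) c s t s' -> exec O c s t s'.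
Proof.
move=> + H; elim: H => {c s t s'} /=.
- by move=> *; constructor.
- by [].
- move=> c1 c2 s t1 s1 t2 s2 _ IH1 _ IH2 /andP[/IH1 ex1 /IH2 ex2].
  exact: ExecSeq ex1 ex2.
- by move=> e c1 c2 s t s' es _ IH /andP[/IH ? _]; apply: ExecIfTrue.
- by move=> e c1 c2 s t s' es _ IH /andP[_ /IH ?]; apply: ExecIfFalse.
- move=> e c s t1 s1 t2 s2 es _ IH1 _ IH2 of_c.
  exact: ExecWhileTrue es (IH1 of_c) (IH2 of_c).
- by move=> *; apply: ExecWhileFalse.
- by move=> x c e s t s' _ IH of_c; constructor; apply: IH.
Qed.

Lemma runs_within_oracle_free c v w b :
  oracle_free c -> runs_within (@no_oracle R) c v w b -> runs_within O c v w b.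
Proof.
by move=> of_c [t [s [ex sw tb]]]; exists t, s; split=> //; apply: exec_oracle_free.
Qed.

Lemma runs_within_leq c v w b b' :
  (b <= b')%N -> runs_within O c v w b -> runs_within O c v w b'.
Proof.
by move=> bb' [t [s [ex sw tb]]]; exists t, s; split=> //; apply: leq_trans tb bb'.
Qed.

(** Total correctness with cost: the postcondition also receives the number of steps, so time bounds
    add up along the program. *)
Definition wp c s (Q : nat -> store R -> Prop) : Prop :=
  exists t s', exec O c s t s' /\ Q t s'.

Lemma wp_run c v w b :
  wp c (init v) (fun t s => s 0%N = w /\ (t <= b)%N) -> runs_within O c v w b.
Proof. by move=> [t [s [ex [sw tb]]]]; exists t, s. Qed.

Lemma wp_assign x e s (Q : nat -> store R -> Prop) :
  Q 1%N (update s x (eval s e)) -> wp (Assign x e) s Q.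
Proof. by exists 1%N, (update s x (eval s e)); split=> //; constructor. Qed.

Lemma wp_query v w x e s (Q : nat -> store R -> Prop) :
  O v = w -> eval s e = v -> Q 1%N (update s x w) -> wp (Query x e) s Q.
Proof.
by move=> <- <- ?; exists 1%N, (update s x (O (eval s e))); split=> //; constructor.
Qed.

Lemma wp_seq c1 c2 s (Q : nat -> store R -> Prop) :
  wp c1 s (fun t1 s1 => wp c2 s1 (fun t2 s2 => Q (t1 + t2)%N s2)) ->
  wp (Seq c1 c2) s Q.
Proof.
move=> [t1 [s1 [ex1 [t2 [s2 [ex2 q]]]]]]; exists (t1 + t2)%N, s2.
by split=> //; apply: ExecSeq ex1 ex2.
Qed.

Lemma wp_if e c1 c2 s (Q : nat -> store R -> Prop) :
  wp (if truthy (eval s e) then c1 else c2) s (fun t s' => Q t.+1 s') ->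
  wp (If e c1 c2) s Q.
Proof.
case es: (truthy (eval s e)) => -[t [s' [ex q]]]; exists t.+1, s'; split=> //.
  by apply: ExecIfTrue; rewrite ?es.
by apply: ExecIfFalse; rewrite ?es.
Qed.

Lemma wp_call v w b x c e s (Q : nat -> store R -> Prop) :
  runs_within O c v w b -> eval s e = v ->
  (forall t, (t <= b)%N -> Q t.+1 (update s x w)) -> wp (Call x c e) s Q.
Proof.
move=> [t [s' [ex <- tb]]] ev q; subst v; exists t.+1, (update s x (s' 0%N)).
by split; [constructor | apply: q].
Qed.

(** The loop state is one record in variable 0, whose first field is a list or a unary counter; the
    loop stops when it is empty. Running the body through [Call] gives it fresh local variables. *)
Definition loop (body : cmd) : cmd := While (EFst (Var 0)) (Call 0 body (Var 0)).

Definition more v : bool := if v is Node a _ then truthy a else false.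

(** Each iteration pays two steps beyond its body, for the test and the call; the last step is the
    failing test. *)
Lemma loop_run (I : nat -> tree R -> Prop) (N b : nat) body v :
  I 0%N v ->
  (forall k u, (k < N)%N -> I k u ->
     more u /\ exists2 u', runs_within O body u u' b & I k.+1 u') ->
  (forall u, I N u -> ~~ more u) ->
  exists2 u, runs_within O (loop body) v u (N * b.+2).+1 & I N u.
Proof.
move=> I0 step stop.
have run k s : (k <= N)%N -> I k (s 0%N) -> exists t s',
    [/\ exec O (loop body) s t s', I N (s' 0%N) & (t <= ((N - k) * b.+2).+1)%N].
  move=> kN; rewrite -(subKn kN); move: (N - k)%N (leq_subr k N) => {kN}k.
  elim: k s => [|k IH] s kN Is.
    exists 1%N, s; rewrite subn0 in Is; split=> //.
    apply: ExecWhileFalse; move: (stop _ Is) => /=.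
    by case: (s 0%N).
  have lt_k : (N - k.+1 < N)%N by lia.
  have [mr [u' [t1 [s1 [ex1 s1u tb]]] Iu']] := step _ _ lt_k Is.
  have Ek : (N - k.+1).+1 = (N - k)%N by lia.
  rewrite Ek in Iu'.
  have [] := IH (update s 0 (s1 0%N)) _ _; first by lia.
    by rewrite /update eqxx s1u.
  move=> t2 [s2 [ex2 I2 tb2]]; exists (t1.+1 + t2).+1, s2; split=> //.
    apply: ExecWhileTrue ex2; last by constructor.
    by move: mr => /=; case: (s 0%N).
  have Nk1 : (N - (N - k.+1) = k.+1)%N by lia.
  rewrite Nk1.
  have Nk : (N - (N - k) = k)%N by lia.
  by rewrite mulSn; rewrite Nk in tb2; lia.
have [t [s [ex Is tb]]] := run 0%N (init v) isT I0.
by exists (s 0%N) => //; exists t, s; rewrite subn0 in tb.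
Qed.

Lemma loop_ends (I : nat -> tree R -> Prop) (N b : nat) body v w :
  I 0%N v ->
  (forall k u, (k < N)%N -> I k u ->
     more u /\ exists2 u', runs_within O body u u' b & I k.+1 u') ->
  (forall u, I N u -> u = w) -> ~~ more w ->
  runs_within O (loop body) v w (N * b.+2).+1.
Proof.
move=> I0 step end_w stop; have [u /end_w -> //|u run /end_w <- //] := loop_run I0 step _.
Qed.

End Language.

(** * Closure properties of polynomially bounded functions *)

Section Polynomials.

Definition poly_bounded (f : nat -> nat) : Prop :=
  exists d, forall s, (f s <= poly_bound d s)%N.

Lemma poly_bounded_const c : poly_bounded (fun=> c).
Proof. by exists c => s; rewrite /poly_bound leq_pmulr // expn_gt0. Qed.

Lemma poly_bounded_id : poly_bounded id.
Proof. by exists 1%N => s; rewrite /poly_bound mul1n expn1. Qed.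

Lemma poly_bounded_add f g :
  poly_bounded f -> poly_bounded g -> poly_bounded (fun s => f s + g s)%N.
Proof.
move=> [d df] [e eg]; exists (d + e)%N => s; rewrite /poly_bound mulnDl.
by apply: leq_add; [apply: leq_trans (df s) _ | apply: leq_trans (eg s) _];
  rewrite leq_mul // leq_pexp2l ?leq_addr ?leq_addl.
Qed.

Lemma poly_bounded_mul f g :
  poly_bounded f -> poly_bounded g -> poly_bounded (fun s => f s * g s)%N.
Proof.
(* A single number bounds coefficient and exponent: [d * e] serves the former and [d + e] the
   latter. *)
move=> [d df] [e eg]; exists (d * e + (d + e))%N => s.
apply: leq_trans (leq_mul (df s) (eg s)) _; rewrite /poly_bound.
by rewrite mulnACA -expnD leq_mul ?leq_pexp2l ?leq_addr ?leq_addl.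
Qed.

Lemma poly_bounded_succ f : poly_bounded f -> poly_bounded (fun s => (f s).+1).
Proof.
move=> /poly_bounded_add /(_ (poly_bounded_const 1)) [d df].
by exists d => s; rewrite -addn1.
Qed.

Lemma poly_bound_mono d s s' : (s <= s')%N -> (poly_bound d s <= poly_bound d s')%N.
Proof. by case: d => // d ss'; rewrite /poly_bound leq_mul2l leq_exp2r. Qed.

Lemma poly_bounded_exp f k : poly_bounded f -> poly_bounded (fun s => f s ^ k)%N.
Proof.
move=> pf; elim: k => [|k [d dk]]; first exact: poly_bounded_const 1%N.
have [e ek] := poly_bounded_mul pf (ex_intro _ d dk).
by exists e => s; rewrite expnS.
Qed.

End Polynomials.

(** * The programs *)

Section Programs.
Variable Pon : cmd.

(* Records are right-nested pairs: [fld k] is the k-th component of the input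
   and [rest k] what follows the first k components. *)
Definition rest (k : nat) : expr := iter k ESnd (Var 0).
Definition fld (k : nat) : expr := EFst (rest k).
Definition epairs (es : seq expr) (e : expr) : expr := foldr EPair e es.

(** It serves both to bring a request list into order of arrival and to close the zipper on a bit
    list. *)
Definition catrev_cmd : cmd :=
  loop (Assign 0 (EPair (ESnd (fld 0)) (EPair (EFst (fld 0)) (rest 1)))).

Definition cost_cmd : cmd :=
  loop (Seq (If (EFst (fld 0))
               (Assign 1 (EAdd (rest 2) (EFst (fld 1))))
               (Assign 1 (rest 2)))
            (Assign 0 (epairs [:: ESnd (fld 0); ESnd (fld 1)] (Var 1)))).

(* (instance, reversed request sequence) |-> (online solution, its cost) *)
Definition online_cmd : cmd :=
  Seq (Call 1 catrev_cmd (EPair (rest 1) ENil))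
 (Seq (Call 2 Pon (EPair (fld 0) (ESnd (Var 1))))
 (Seq (Call 3 cost_cmd
        (epairs [:: Var 2; EFst (ESnd (ESnd (fld 0)))] EZero))
      (Assign 0 (EPair (Var 2) (ESnd (ESnd (Var 3))))))).

(* One pass over the requirements: fields 0 and 1 form a zipper on the bit
   list of the current scenario, field 2 is the index reached, fields 3-5 are
   the instance, the index of the p-system and the requests so far, and the
   rest is the best extension found, with its cost in front. *)
Definition scan_body : cmd :=
  Seq (If (EFst (fld 0))
         (Assign 1 ENil)
         (Seq (Call 2 catrev_cmd
                (epairs [:: fld 1; EPair ENil ENil] (ESnd (fld 0))))
              (Query 1 (EPair (fld 4) (ESnd (Var 2))))))
 (Seq (If (Var 1)
         (Seq (Call 3 online_cmd (epairs [:: fld 3; fld 2] (fld 5)))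
              (If (ELe (fld 6) (ESnd (Var 3)))
                 (Assign 4 (epairs [:: ESnd (Var 3); EPair (fld 2) (fld 5)]
                              (ESnd (Var 2))))
                 (Assign 4 (rest 6))))
         (Assign 4 (rest 6)))
      (Assign 0 (epairs [:: ESnd (fld 0); EPair (EFst (fld 0)) (fld 1);
                            EPair ENil (fld 2); fld 3; fld 4; fld 5] (Var 4)))).

(* Input: instance, index of the p-system, requests, scenario.  The initial
   cost -1 is below the cost of every candidate. *)
Definition greedy_step_cmd : cmd :=
  Seq (Call 1 (loop scan_body)
        (epairs [:: rest 3; ENil; ENil; fld 0; fld 1; fld 2;
                    ESub EZero EOne; fld 2] (rest 3)))
      (Assign 0 (iter 7 ESnd (Var 1))).

(** Fields: remaining steps, instance, index of the p-system; the rest is the pair of requests and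
    scenario that a greedy step returns. *)
Definition greedy_body : cmd :=
  Seq (Call 1 greedy_step_cmd (rest 1))
      (Assign 0 (epairs [:: ESnd (fld 0); fld 1; fld 2] (Var 1))).

Definition greedy_cmd : cmd := loop greedy_body.

(* [enc_nat n] also encodes the empty set of ['I_n]. *)
Definition best_system_body : cmd :=
  Seq (Call 1 greedy_cmd
        (epairs [:: EFst (ESnd (fld 1)); fld 1; ESnd (fld 0); fld 2]
           (EFst (ESnd (fld 1)))))
 (Seq (Call 2 online_cmd (EPair (fld 1) (EFst (iter 3 ESnd (Var 1)))))
 (Seq (If (ELe (fld 3) (ESnd (Var 2)))
         (Assign 3 (EPair (ESnd (Var 2)) (EFst (iter 3 ESnd (Var 1)))))
         (Assign 3 (rest 3)))
      (Assign 0 (epairs [:: ESnd (fld 0); fld 1; fld 2] (Var 3))))).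

Definition best_system_cmd : cmd := loop best_system_body.

(* Fields: remaining rounds, instance, (lambda, number of systems), requests,
   value of the best first stage so far (a non-number at the start); the rest
   is that first stage. *)
Definition round_body : cmd :=
  Seq (Call 1 online_cmd (EPair (fld 1) (fld 3)))
 (Seq (Call 2 best_system_cmd
        (epairs [:: ESnd (fld 2); fld 1; fld 3; ESnd (Var 1)] (fld 3)))
 (Seq (Assign 3 (EAdd (ESnd (Var 1))
         (EMul (EFst (fld 2))
            (ESub (EFst (iter 3 ESnd (Var 2))) (ESnd (Var 1))))))
 (Seq (If (EIsNum (fld 4))
         (If (ELe (fld 4) (Var 3))
            (Assign 4 (rest 4))
            (Assign 4 (EPair (Var 3) (EFst (Var 1)))))
         (Assign 4 (EPair (Var 3) (EFst (Var 1)))))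
      (Assign 0 (epairs [:: ESnd (fld 0); fld 1; fld 2; iter 4 ESnd (Var 2)]
                   (Var 4)))))).

(** Prepending [ENil] to the unary number of elements makes the counter one larger than that number.
    The later [ENil] fields stand for no requests and no value yet. *)
Definition first_stage_cmd : cmd :=
  Seq (Call 1 (loop round_body)
        (epairs [:: EPair ENil (EFst (fld 0)); fld 0; rest 1; ENil; ENil] ENil))
      (Assign 0 (iter 5 ESnd (Var 1))).

End Programs.

Definition second_stage_cmd (Poff : cmd) : cmd :=
  Call 0 Poff (EPair (EFst (fld 0)) (rest 1)).

(** * Sizes and manipulation of encoded numbers, lists and sets *)

Section Encodings.
Variable R : realFieldType.

Lemma enc_nat_set0 n : enc_set R (set0 : {set 'I_n}) = enc_nat R n.
Proof.
rewrite /enc_set -[n in RHS]size_enum_ord.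
by elim: (enum _) => //= i e <-; rewrite inE.
Qed.

Lemma tsize_enc_nat k : Defs.tsize (enc_nat R k) = k.*2.+1.
Proof. by elim: k => //= k; rewrite -/(enc_nat R k) => ->; lia. Qed.

Lemma tsize_enc_seq (b : nat) (us : seq (tree R)) :
  all (fun u => Defs.tsize u <= b)%N us ->
  (Defs.tsize (enc_seq us) <= (size us * b.+1).+1)%N.
Proof.
elim: us => //= u us IH /andP[ub /IH].
by rewrite mulSn -/(enc_seq us); lia.
Qed.

Lemma tsize_enc_set (k : nat) (A : {set 'I_k}) :
  (Defs.tsize (enc_set R A) <= (k * 4).+1)%N.
Proof.
rewrite -[k in leqRHS]size_enum_ord -(size_map (fun i => enc_bool R (i \in A))).
by apply: tsize_enc_seq; rewrite all_map; apply/allP => i _ /=; case: (i \in A).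
Qed.

Lemma enum_drop (n k : nat) (lt_k_n : (k < n)%N) :
  drop k (enum 'I_n) = Ordinal lt_k_n :: drop k.+1 (enum 'I_n).
Proof.
rewrite (drop_nth (Ordinal lt_k_n)) ?size_enum_ord //.
by rewrite (nth_ord_enum _ (Ordinal lt_k_n)).
Qed.

Lemma enum_take (n k : nat) (lt_k_n : (k < n)%N) :
  take k.+1 (enum 'I_n) = rcons (take k (enum 'I_n)) (Ordinal lt_k_n).
Proof.
rewrite (take_nth (Ordinal lt_k_n)) ?size_enum_ord //.
by rewrite (nth_ord_enum _ (Ordinal lt_k_n)).
Qed.

(** Closing the zipper with a one at position [k] produces the set on which the membership oracle is
    queried. *)
Lemma enc_setU1 (n k : nat) (lt_k_n : (k < n)%N) (W : {set 'I_n}) :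
  let bits := [seq enc_bool R (i \in W) | i <- enum 'I_n] in
  enc_seq (take k bits ++ Node Leaf Leaf :: drop k.+1 bits) =
  enc_set R (Ordinal lt_k_n |: W).
Proof.
rewrite /= /enc_set; congr enc_seq.
have := cat_take_drop k (enum 'I_n); rewrite (enum_drop lt_k_n) => E.
have : uniq (enum 'I_n) by apply: enum_uniq.
rewrite -{1}E cat_uniq /= => /and3P[_ /norP[o_take _] /andP[o_drop _]].
rewrite -map_take -map_drop -[in RHS]E map_cat /= setU11; congr (_ ++ _ :: _).
  apply/eq_in_map => i ti; rewrite !inE; case: eqP ti o_take => // -> ->.
  by [].
by apply/eq_in_map => i ti; rewrite !inE; case: eqP ti o_drop => // -> ->.
Qed.

End Encodings.

Section BasicRuns.
Variables (R : realFieldType) (O : tree R -> tree R).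

Lemma catrev_run (b : nat) (us vs : seq (tree R)) : (size us <= b)%N ->
  runs_within O catrev_cmd (Node (enc_seq us) (enc_seq vs))
    (Node Leaf (enc_seq (catrev us vs))) (b * 3).+1.
Proof.
move=> ub; apply: (@runs_within_leq _ _ _ _ _ (size us * 3).+1); first by lia.
apply: (loop_ends (I := fun k u =>
  u = Node (enc_seq (drop k us)) (enc_seq (catrev (take k us) vs)))) => //.
- by rewrite drop0 take0.
- move=> k u lt_k ->; rewrite (drop_nth Leaf lt_k); split=> //=.
  eexists; first by apply: wp_run; apply: wp_assign; split.
  by rewrite /= (take_nth Leaf lt_k) !catrevE rev_rcons.
- by move=> u ->; rewrite drop_size take_size.
Qed.

Lemma cost_run (m n : nat) (C : covering R m n) (A : {set 'I_m}) (b : nat) :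
  (m <= b)%N ->
  runs_within O cost_cmd
    (Node (enc_set R A)
       (Node (enc_seq [seq Scalar (ecost C e) | e <- enum 'I_m]) (Scalar 0)))
    (Node Leaf (Node Leaf (Scalar (cost C A)))) (b * 5).+1.
Proof.
move=> mb; apply: (@runs_within_leq _ _ _ _ _ (m * 5).+1); first by lia.
apply: (loop_ends (I := fun k u =>
  u = Node (enc_seq [seq enc_bool R (e \in A) | e <- drop k (enum 'I_m)])
       (Node (enc_seq [seq Scalar (ecost C e) | e <- drop k (enum 'I_m)])
         (Scalar (\sum_(e <- take k (enum 'I_m) | e \in A) ecost C e))))) => //.
- by rewrite drop0 take0 big_nil.
- move=> k u lt_k ->; rewrite (enum_drop lt_k) (enum_take lt_k); split=> //.
  eexists; last by [].
  apply: wp_run; apply: wp_seq; apply: wp_if; rewrite big_rcons /=.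
  by case: (_ \in A); do 2!apply: wp_assign; rewrite ?addr0; split.
- move=> u ->; rewrite !drop_oversize ?take_oversize ?size_enum_ord //=.
  by rewrite /cost big_enum_cond.
Qed.
End BasicRuns.

(** * Correctness and running time of the programs *)

Section InstanceRuns.
Variables (R : realFieldType) (O : tree R -> tree R) (C : covering_family R).
Variable x : inst C.
Variables (Pon : cmd) (Aon : seq 'I_(nreqs x) -> {set 'I_(nelts x)}).
(** [S] bounds the numbers of elements and requirements, [N] the length of the request sequences,
    and [ton] the time of the online algorithm on these. *)
Variables (S N ton : nat).

Local Notation m := (nelts x).
Local Notation n := (nreqs x).
Local Notation Cx := (problem x).
Local Notation ix := (enc_inst x).

Definition enc_reqs (rs : seq 'I_n) : tree R :=
  enc_seq [seq enc_nat R (nat_of_ord i) | i <- rs].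

(** Programs and greedy runs keep the latest request first, whereas the online algorithm reads
    requests in order of arrival. *)
Definition online_rev (rs : seq 'I_n) : {set 'I_m} := Aon (rev rs).

Local Notation A := online_rev.
Local Notation f rs := (cost Cx (A rs)).

Hypothesis mS : (m <= S)%N.
Hypothesis nS : (n <= S)%N.
Hypothesis Pon_run : forall sigma : seq 'I_n, (size sigma <= N)%N ->
  runs_within O Pon (enc_online sigma) (enc_set R (Aon sigma)) ton.

Definition online_time : nat := (N * 3 + S * 5 + ton + 10)%N.

Lemma online_run rs : (size rs <= N)%N ->
  runs_within O (online_cmd Pon) (Node ix (enc_reqs rs))
    (Node (enc_set R (A rs)) (Scalar (f rs))) online_time.
Proof.
move=> rsN; apply: wp_run; apply: wp_seq.
have rsN' : (size [seq enc_nat R (nat_of_ord i) | i <- rs] <= N)%N by rewrite size_map.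
apply: (wp_call (catrev_run O [::] rsN')) => [//|t1 ht1].
apply: wp_seq; rewrite catrevE cats0 -map_rev.
have rrsN : (size (rev rs) <= N)%N by rewrite size_rev.
apply: (wp_call (Pon_run rrsN)) => [//|t2 ht2]; apply: wp_seq.
apply: (wp_call (cost_run O Cx (A rs) mS)) => [//|t3 ht3].
by apply: wp_assign; split=> //; rewrite /online_time; lia.
Qed.

Section System.
Variables (M : {set {set 'I_n}}) (j : tree R).
Hypothesis oracle : forall w, O (Node j (enc_set R w)) = enc_bool R (w \in M).

Definition best_below (W : {set 'I_n}) (rs : seq 'I_n) (k : nat) (v : R)
    (rs' : seq 'I_n) (W' : {set 'I_n}) : Prop :=
  [/\ v = -1, rs' = rs, W' = W &
      forall i : 'I_n, (i < k)%N -> ~~ candidate M W i] \/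
  exists i, [/\ candidate M W i, v = f (i :: rs), rs' = i :: rs, W' = i |: W &
      forall i' : 'I_n, (i' < k)%N -> candidate M W i' -> f (i' :: rs) <= f (i :: rs)].

Lemma best_below_skip W rs k v rs' W' (lt_k : (k < n)%N) :
  ~~ candidate M W (Ordinal lt_k) ->
  best_below W rs k v rs' W' -> best_below W rs k.+1 v rs' W'.
Proof.
move=> Nk [[-> -> -> none]|[i [ci -> -> -> maxi]]]; [left|right].
  split=> // i; rewrite ltnS leq_eqVlt => /orP[/eqP ik|]; last exact: none.
  by rewrite (_ : i = Ordinal lt_k) //; apply: val_inj.
exists i; split=> // i'; rewrite ltnS leq_eqVlt => /orP[/eqP ik|]; last exact: maxi.
by rewrite (_ : i' = Ordinal lt_k) ?(negPf Nk) //; apply: val_inj.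
Qed.

(** The initial value -1 cannot survive a comparison, costs being nonnegative; so a kept value
    belongs to an earlier candidate. *)
Lemma best_below_keep W rs k v rs' W' (lt_k : (k < n)%N) :
  (v <= f (Ordinal lt_k :: rs)) = false ->
  best_below W rs k v rs' W' -> best_below W rs k.+1 v rs' W'.
Proof.
move=> small [[v1 _ _ _]|[i [ci vi -> -> maxi]]]; last right.
  by have := cost_ge0 Cx (A (Ordinal lt_k :: rs)); move: small; rewrite v1; lra.
exists i; split=> // i'; rewrite ltnS leq_eqVlt => /orP[/eqP ik _|]; last exact: maxi.
rewrite (_ : i' = Ordinal lt_k); last exact: val_inj.
by rewrite -vi ltW // ltNge small.
Qed.

Lemma best_below_replace W rs k v rs' W' (lt_k : (k < n)%N) :
  candidate M W (Ordinal lt_k) -> v <= f (Ordinal lt_k :: rs) ->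
  best_below W rs k v rs' W' ->
  best_below W rs k.+1 (f (Ordinal lt_k :: rs)) (Ordinal lt_k :: rs)
    (Ordinal lt_k |: W).
Proof.
move=> ck large prev; right; exists (Ordinal lt_k); split=> // i'.
rewrite ltnS leq_eqVlt => /orP[/eqP ik _|lt_i ci'].
  by rewrite (_ : i' = Ordinal lt_k) //; apply: val_inj.
case: prev => [[_ _ _ none]|[i [_ vi _ _ maxi]]].
  by rewrite (negPf (none _ lt_i)) in ci'.
by apply: le_trans large; rewrite vi maxi.
Qed.

Definition scan_body_time : nat := (S * 3 + online_time + 12)%N.

Definition scan_state (W : {set 'I_n}) (rs : seq 'I_n) (k : nat) (v : R)
    (rs' : seq 'I_n) (W' : {set 'I_n}) : tree R :=
  let bits := [seq enc_bool R (i \in W) | i <- enum 'I_n] in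
  Node (enc_seq (drop k bits)) (Node (enc_seq (rev (take k bits)))
    (Node (enc_nat R k) (Node ix (Node j (Node (enc_reqs rs)
      (Node (Scalar v) (Node (enc_reqs rs') (enc_set R W')))))))).

Lemma scan_body_run W rs k v rs' W' : (size rs < N)%N -> (k < n)%N ->
  best_below W rs k v rs' W' ->
  exists v1 rs1 W1, best_below W rs k.+1 v1 rs1 W1 /\
    runs_within O (scan_body Pon) (scan_state W rs k v rs' W')
      (scan_state W rs k.+1 v1 rs1 W1) scan_body_time.
Proof.
move=> rsN lt_k best; rewrite /scan_state; set bits := map _ _.
have size_bits : size bits = n by rewrite size_map size_enum_ord.
have bit_k : nth Leaf bits k = enc_bool R (Ordinal lt_k \in W).
  by rewrite (nth_map (Ordinal lt_k)) ?size_enum_ord // (nth_ord_enum _ (Ordinal lt_k)).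
have preS : (size (rev (take k bits)) <= S)%N.
  by rewrite size_rev size_take size_bits lt_k; lia.
have rev1 : catrev (rev (take k bits)) (Node Leaf Leaf :: drop k.+1 bits) =
            take k bits ++ Node Leaf Leaf :: drop k.+1 bits.
  by rewrite catrevE revK.
rewrite (drop_nth Leaf) ?size_bits // (take_nth Leaf) ?size_bits // rev_rcons bit_k.
have [Wk|Wk] := boolP (Ordinal lt_k \in W).
  have Nk : ~~ candidate M W (Ordinal lt_k) by rewrite /candidate Wk.
  exists v, rs', W'; split; first exact: best_below_skip Nk best.
  apply: wp_run; apply: wp_seq; apply: wp_if; apply: wp_assign.
  apply: wp_seq; apply: wp_if; apply: wp_assign; apply: wp_assign.
  by split=> //; rewrite /scan_body_time; lia.
have orac := oracle (Ordinal lt_k |: W).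
have catrev1 := catrev_run O (Node Leaf Leaf :: drop k.+1 bits) preS.
rewrite rev1 enc_setU1 in catrev1.
have candE : candidate M W (Ordinal lt_k) = (Ordinal lt_k |: W \in M).
  by rewrite /candidate Wk.
case ck: (candidate M W (Ordinal lt_k)); rewrite -candE ck in orac; last first.
  exists v, rs', W'; split; first by apply: best_below_skip best; rewrite ck.
  apply: wp_run; apply: wp_seq; apply: wp_if; apply: wp_seq.
  apply: (wp_call catrev1) => [//|t1 ht1].
  apply: (wp_query orac) => [//|]; apply: wp_seq; apply: wp_if; apply: wp_assign.
  by apply: wp_assign; split=> //; rewrite /scan_body_time; lia.
have onl := @online_run (Ordinal lt_k :: rs) rsN.
case large: (v <= f (Ordinal lt_k :: rs)).
  exists (f (Ordinal lt_k :: rs)), (Ordinal lt_k :: rs), (Ordinal lt_k |: W).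
  split; first exact: best_below_replace ck large best.
  apply: wp_run; apply: wp_seq; apply: wp_if; apply: wp_seq.
  apply: (wp_call catrev1) => [//|t1 ht1].
  apply: (wp_query orac) => [//|]; apply: wp_seq; apply: wp_if; apply: wp_seq.
  apply: (wp_call onl) => [//|t2 ht2]; apply: wp_if.
  rewrite /= large; apply: wp_assign; apply: wp_assign.
  by split=> //; rewrite /scan_body_time; lia.
exists v, rs', W'; split; first exact: best_below_keep large best.
apply: wp_run; apply: wp_seq; apply: wp_if; apply: wp_seq.
apply: (wp_call catrev1) => [//|t1 ht1].
apply: (wp_query orac) => [//|]; apply: wp_seq; apply: wp_if; apply: wp_seq.
apply: (wp_call onl) => [//|t2 ht2]; apply: wp_if.
rewrite /= large; apply: wp_assign; apply: wp_assign.
by split=> //; rewrite /scan_body_time; lia.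
Qed.

Lemma scan_run W rs : (size rs < N)%N ->
  exists v rs' W', best_below W rs n v rs' W' /\
    runs_within O (loop (scan_body Pon)) (scan_state W rs 0 (-1) rs W)
      (scan_state W rs n v rs' W') (S * scan_body_time.+2).+1.
Proof.
move=> rsN; pose I k u := exists v rs' W',
  u = scan_state W rs k v rs' W' /\ best_below W rs k v rs' W'.
have [|k u lt_k [v [rs' [W' [-> best]]]]|u [v [rs' [W' [-> _]]]]|
      u run [v [rs' [W' [Eu best]]]]] := @loop_run R O I n scan_body_time
    (scan_body Pon) (scan_state W rs 0 (-1) rs W) _ _ _.
- by exists (-1), rs, W; split=> //; left.
- split; first by rewrite /scan_state (drop_nth Leaf) // size_map size_enum_ord.
  have [v1 [rs1 [W1 [best1 run1]]]] := scan_body_run rsN lt_k best.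
  by exists (scan_state W rs k.+1 v1 rs1 W1) => //; exists v1, rs1, W1.
- by rewrite /scan_state drop_oversize // size_map size_enum_ord.
exists v, rs', W'; split=> //; rewrite -Eu; apply: runs_within_leq run.
by rewrite ltnS leq_mul2r nS orbT.
Qed.

Definition greedy_step_time : nat := ((S * scan_body_time.+2).+1 + 2)%N.

Lemma greedy_step_run W rs : (size rs < N)%N ->
  exists rs' W',
    runs_within O (greedy_step_cmd Pon)
      (Node ix (Node j (Node (enc_reqs rs) (enc_set R W))))
      (Node (enc_reqs rs') (enc_set R W')) greedy_step_time /\
    ((rs' = rs /\ W' = W /\ forall i, ~~ candidate M W i) \/
     exists i, [/\ greedy_pick Cx A M W rs i, rs' = i :: rs & W' = i |: W]).
Proof.
move=> rsN; have [v [rs' [W' [best run]]]] := scan_run W rsN.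
exists rs', W'; split.
  apply: wp_run; apply: wp_seq; apply: (wp_call run) => [|t1 ht1].
    by rewrite /scan_state drop0 take0 /= sub0r.
  by apply: wp_assign; split=> //; rewrite /greedy_step_time; lia.
case: best => [[_ -> -> none]|[i [ci _ -> -> maxi]]]; [left|right].
  by split=> //; split=> // i; apply: none.
by exists i; split=> //; split=> // i'; apply: maxi.
Qed.

Definition greedy_time : nat := (S * (greedy_step_time + 2).+2).+1.

Lemma greedy_run rs : (size rs + n < N)%N ->
  exists r, greedy_maximal Cx A M rs r /\
    runs_within O (greedy_cmd Pon)
      (Node (enc_nat R n) (Node ix (Node j (Node (enc_reqs rs) (enc_nat R n)))))
      (Node Leaf (Node ix (Node j (Node (enc_reqs (r ++ rs)) (enc_set R [set i in r])))))
      greedy_time.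
Proof.
(* Once no candidate is left, further iterations change nothing but the counter; until then the run
   has exactly [k] picks. *)
move=> rsN; pose I k u := exists r,
  u = Node (enc_nat R (n - k))
       (Node ix (Node j (Node (enc_reqs (r ++ rs)) (enc_set R [set i in r])))) /\
  (greedy_maximal Cx A M rs r \/ greedy_chain Cx A M rs r /\ size r = k).
have [|k u lt_k [r [-> progress]]|u [r [-> _]]|
      u run [r [Eu progress]]] := @loop_run R O I n (greedy_step_time + 2) 
    (greedy_body Pon)
   (Node (enc_nat R n) (Node ix (Node j (Node (enc_reqs rs) (enc_nat R n))))) _ _ _.
- exists [::]; rewrite subn0 -enc_nat_set0; split; last by right.
  by do 4!congr Node; congr enc_set; apply/setP => i; rewrite !inE.
- have nk : (n - k = (n - k.+1).+1)%N by lia.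
  have chain : greedy_chain Cx A M rs r by case: progress => -[].
  have rn := greedy_chain_size chain.
  have rrsN : (size (r ++ rs) < N)%N by rewrite size_cat; lia.
  have [rs' [W' [run result]]] := greedy_step_run [set i in r] rrsN.
  rewrite nk; split=> //.
  exists (Node (enc_nat R (n - k.+1))
           (Node ix (Node j (Node (enc_reqs rs') (enc_set R W'))))).
    apply: wp_run; apply: wp_seq; apply: (wp_call run) => [//|t1 ht1].
    by apply: wp_assign; split=> //; lia.
  case: result => [[-> [-> none]]|[i [pick -> ->]]].
    by exists r; split=> //; left.
  exists (i :: r); rewrite -set_cons; split=> //; right.
  case: progress => [[_ maxr]|[_ <-]]; last by [].
  by case: pick => ci; rewrite (negPf (maxr i)) in ci.
- by rewrite subnn.
exists r; split.
  case: progress => // -[chain sr]; split=> // i.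
  (* A run of [n] distinct picks exhausts all requirements. *)
  suff -> : [set i in r] = setT by rewrite /candidate inE.
  apply/eqP; rewrite eqEcard subsetT /= cardsT card_ord cardsE.
  by rewrite (card_uniqP (greedy_chain_uniq chain)) sr.
move: Eu; rewrite subnn => <-; apply: runs_within_leq run.
by rewrite ltnS leq_mul2r nS orbT.
Qed.

End System.

Variables (L ell : nat) (Sigma : 'I_L -> {set {set 'I_n}}) (p : R).
Hypothesis L_ell : (L <= ell)%N.
Hypothesis Sigma_p : forall j, p_system p (Sigma j).
Hypothesis O_Sigma : membership_oracle Sigma O.
Hypothesis A_sat : forall rs, satisfies Cx (A rs) [set i in rs].
Hypothesis A_mono : forall i rs, A rs \subset A (i :: rs).

Local Notation U := (\bigcup_j Sigma j).

Lemma union_p_ge1 w : w \in U -> w != set0 -> 1 <= p.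
Proof. by move=> /bigcupP[j _ wj]; apply: p_system_ge1 (Sigma_p j) _ wj. Qed.

Lemma round_step_max rs r :
  (size r <= n)%N -> r = [::] \/ [set i in r] \in U ->
  (forall j, exists r', greedy_maximal Cx A (Sigma j) rs r' /\
     f (r' ++ rs) <= f (r ++ rs)) ->
  round_step Cx A U p rs (r ++ rs).
Proof.
move=> rn rU best; split; first by exists r.
move=> w Uw; have gain : 0 <= f (r ++ rs) - f rs.
  by rewrite subr_ge0 cost_mono ?online_cat.
have [->|w0] := eqVneq w set0.
  (* If [p + 1] is negative, [U] has no nonempty scenario, so the round has fed nothing and its gain
     is 0. *)
  rewrite opt_aug_set0; case: (boolP (0 <= p + 1)) => [p1|p1].
    exact: mulr_ge0.
  case: rU => [->|rU]; first by rewrite subrr mulr0.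
  have [r0|r0] := eqVneq [set i in r] set0.
    case: r r0 {rn best gain rU} => [|i r] r0; first by rewrite subrr mulr0.
    by move/setP/(_ i): r0; rewrite !inE eqxx.
  by have := union_p_ge1 rU r0; move: p1; lra.
have p1 := union_p_ge1 Uw w0; move: Uw => /bigcupP[j _ wj].
have [r' [maxr' le_r']] := best j.
apply: le_trans (greedy_opt_aug A_sat A_mono (Sigma_p j) wj maxr') _.
by rewrite ler_wpM2l ?lerD2r //; lra.
Qed.

Definition best_system_time : nat :=
  (ell * (greedy_time + online_time + 6).+2).+1.

Lemma best_system_run rs : (size rs + n < N)%N ->
  exists rs', round_step Cx A U p rs rs' /\
    runs_within O (best_system_cmd Pon)
      (Node (enc_nat R L) (Node ix (Node (enc_reqs rs)
         (Node (Scalar (f rs)) (enc_reqs rs)))))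
      (Node Leaf (Node ix (Node (enc_reqs rs)
         (Node (Scalar (f rs')) (enc_reqs rs'))))) best_system_time.
Proof.
(* The counter runs down and its predecessor is the index of the next system, so after [k]
   iterations the systems from [L - k] on have been tried. *)
move=> rsN; pose I k u := exists r,
  [/\ u = Node (enc_nat R (L - k)) (Node ix (Node (enc_reqs rs)
           (Node (Scalar (f (r ++ rs))) (enc_reqs (r ++ rs))))),
      (size r <= n)%N, r = [::] \/ [set i in r] \in U &
      forall j : 'I_L, (L - k <= j)%N -> exists r',
        greedy_maximal Cx A (Sigma j) rs r' /\ f (r' ++ rs) <= f (r ++ rs)].
have [|k u lt_k [r [-> rn rU best]]|u [r [-> _ _ _]]|
      u run [r [Eu rn rU best]]] := @loop_run R O I L (greedy_time + online_time + 6)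
    (best_system_body Pon)
   (Node (enc_nat R L) (Node ix (Node (enc_reqs rs)
         (Node (Scalar (f rs)) (enc_reqs rs))))) _ _ _.
- exists [::]; split=> //; first by rewrite subn0.
    by left.
  by move=> j; rewrite subn0 leqNgt ltn_ord.
- have Lk : (L - k = (L - k.+1).+1)%N by lia.
  have lt_j : (L - k.+1 < L)%N by lia.
  have [r' [maxr' grun]] := greedy_run (O_Sigma (Ordinal lt_j)) rsN.
  have r'n := greedy_chain_size (proj1 maxr').
  have r'N : (size (r' ++ rs) <= N)%N by rewrite size_cat; lia.
  have onl := online_run r'N.
  rewrite Lk; split=> //.
  have step r1 : (size r1 <= n)%N -> r1 = [::] \/ [set i in r1] \in U ->
      f (r ++ rs) <= f (r1 ++ rs) -> f (r' ++ rs) <= f (r1 ++ rs) ->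
      I k.+1 (Node (enc_nat R (L - k.+1)) (Node ix (Node (enc_reqs rs)
           (Node (Scalar (f (r1 ++ rs))) (enc_reqs (r1 ++ rs)))))).
    move=> r1n r1U le_r le_r'; exists r1; split=> // j le_j.
    case: (ltnP (L - k.+1) j) => lt_jj.
      have [|r2 [max2 le2]] := best j; first by lia.
      by exists r2; split=> //; apply: le_trans le2 le_r.
    exists r'; split=> //; rewrite (_ : j = Ordinal lt_j) //.
    by apply: val_inj; apply/eqP; rewrite eqn_leq /= lt_jj.
  case large: (f (r ++ rs) <= f (r' ++ rs)).
    eexists; last apply: (step r') => //.
      apply: wp_run; apply: wp_seq; apply: (wp_call grun) => [//|t1 ht1].
      apply: wp_seq; apply: (wp_call onl) => [//|t2 ht2].
      apply: wp_seq; apply: wp_if; rewrite /= large.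
      apply: wp_assign; apply: wp_assign; split=> //; lia.
    case: (greedy_chain_mem (proj1 maxr')) => [->|Mr']; [by left|right].
    by apply/bigcupP; exists (Ordinal lt_j).
  eexists; last apply: (step r) => //.
    apply: wp_run; apply: wp_seq; apply: (wp_call grun) => [//|t1 ht1].
    apply: wp_seq; apply: (wp_call onl) => [//|t2 ht2].
    apply: wp_seq; apply: wp_if; rewrite /= large.
    apply: wp_assign; apply: wp_assign; split=> //; lia.
  by apply: ltW; rewrite ltNge large.
- by rewrite subnn.
exists (r ++ rs); split.
  by apply: round_step_max => // j; apply: best; rewrite subnn.
move: Eu; rewrite subnn => <-; apply: runs_within_leq run.
by rewrite ltnS leq_mul2r L_ell orbT.
Qed.

Variables (lambda alpha : R).
Hypothesis lambda1 : 1 <= lambda.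
Hypothesis A_comp : forall rs, f rs <= alpha * opt Cx [set i in rs].
Hypothesis N_large : ((S * S + S).+1 < N)%N.

Definition first_stage_time : nat :=
  (S.+1 * (online_time + best_system_time + 7).+2 + 3)%N.

Lemma first_stage_run :
  exists E0 v,
    [/\ runs_within O (first_stage_cmd Pon) (enc_robust x lambda L)
          (enc_set R E0) first_stage_time,
        certified Cx A U lambda p E0 v
      & 0 <= alpha -> forall sol, robust_feasible Cx U sol ->
          v <= 2 * alpha * robust_obj Cx U lambda sol].
Proof.
pose start := Node (enc_nat R m.+1) (Node ix (Node (Node (Scalar lambda) (enc_nat R L))
  (Node Leaf (Node Leaf (Leaf : tree R))))).
(* The best value found is good enough against [sol], or all [k] rounds were expensive. The
   alternative is stated for every [sol] because the program knows none of them. *)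
pose promising k v rs := 0 <= alpha -> forall sol, robust_feasible Cx U sol ->
  v <= 2 * alpha * robust_obj Cx U lambda sol \/
  expensive_rounds Cx A U alpha sol k rs.
pose I k u := exists rs bv best,
  [/\ u = Node (enc_nat R (m.+1 - k)) (Node ix
            (Node (Node (Scalar lambda) (enc_nat R L))
            (Node (enc_reqs rs) (Node bv best)))),
      (size rs <= k * n)%N
    & if k is 0 then rs = [::] /\ bv = Leaf else
      exists v E0, [/\ bv = Scalar v, best = enc_set R E0,
        certified Cx A U lambda p E0 v & promising k v rs]].
have [|k u lt_k [rs [bv [best [-> rsn found]]]]|u [rs [bv [best [-> _ _]]]]|
      u run [rs [bv [best [Eu _ [v [E0 [Ev EE0 cert prom]]]]]]]] :=
   @loop_run R O I m.+1 (online_time + best_system_time + 7) (round_body Pon) start _ _ _.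
- by exists [::], Leaf, Leaf; split.
- have mk : (m.+1 - k = (m.+1 - k.+1).+1)%N by lia.
  rewrite mk; split=> //.
  (* At most [m] earlier rounds have fed at most [n] requests each, which keeps the sequences
     shorter than [N]. *)
  have knS : (k * n <= S * S)%N by apply: leq_mul => //; lia.
  have rsN : (size rs + n < N)%N by lia.
  have onl := online_run (ltnW (leq_ltn_trans (leq_addr _ _) rsN)).
  have [rs' [round brun]] := best_system_run rsN.
  have cert' := round_step_certified A_mono lambda round.
  set v' := f rs + lambda * (f rs' - f rs) in cert'.
  have rs'n : (size rs' <= k.+1 * n)%N.
    by case: round => -[r [-> rn _]] _; rewrite size_cat mulSn leq_add.
  have step v1 E1 : certified Cx A U lambda p E1 v1 -> promising k.+1 v1 rs' ->
      I k.+1 (Node (enc_nat R (m.+1 - k.+1)) (Node ix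
            (Node (Node (Scalar lambda) (enc_nat R L))
            (Node (enc_reqs rs') (Node (Scalar v1) (enc_set R E1)))))).
    move=> cert1 prom1; exists rs', (Scalar v1), (enc_set R E1).
    by split=> //; exists v1, E1.
  have prom' : (forall sol, robust_feasible Cx U sol -> 0 <= alpha ->
       expensive_rounds Cx A U alpha sol k rs) -> promising k.+1 v' rs'.
    move=> exp a0 sol feas.
    exact: (expensive_rounds_step A_mono lambda1 A_comp feas a0 (exp _ feas a0) round).
  case: k lt_k rsn found mk knS rs'n step prom' =>
    [|k] lt_k rsn found mk knS rs'n step prom'.
    move: found => [rs0 ->].
    eexists; last apply: (step v' (A rs)) => //.
      apply: wp_run; apply: wp_seq; apply: (wp_call onl) => [//|t1 ht1].
      apply: wp_seq; apply: (wp_call brun) => [//|t2 ht2].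
      apply: wp_seq; apply: wp_assign; apply: wp_seq; apply: wp_if; apply: wp_assign.
      by apply: wp_assign; split=> //; lia.
    by apply: prom' => sol _ _; rewrite rs0; apply: expensive_rounds0.
  move: found => [v [E0 [-> -> cert prom]]].
  case keep: (v <= v').
    eexists; last apply: (step v E0) => //.
      apply: wp_run; apply: wp_seq; apply: (wp_call onl) => [//|t1 ht1].
      apply: wp_seq; apply: (wp_call brun) => [//|t2 ht2].
      apply: wp_seq; apply: wp_assign; apply: wp_seq; apply: wp_if; apply: wp_if.
      rewrite /= -/v' keep; apply: wp_assign.
      by apply: wp_assign; split=> //; lia.
    move=> a0 sol feas; have [le_v|exp] := prom a0 sol feas; first by left.
    have [le_v'|exp'] := expensive_rounds_step A_mono lambda1 A_comp feas a0 exp round.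
      by left; apply: le_trans keep le_v'.
    by right.
  eexists; last apply: (step v' (A rs)) => //.
    apply: wp_run; apply: wp_seq; apply: (wp_call onl) => [//|t1 ht1].
    apply: wp_seq; apply: (wp_call brun) => [//|t2 ht2].
    apply: wp_seq; apply: wp_assign; apply: wp_seq; apply: wp_if; apply: wp_if.
    rewrite /= -/v' keep; apply: wp_assign.
    by apply: wp_assign; split=> //; lia.
  move=> a0 sol feas; have [le_v|exp] := prom a0 sol feas.
    by left; apply: le_trans le_v; apply: ltW; rewrite ltNge keep.
  exact: (expensive_rounds_step A_mono lambda1 A_comp feas a0 exp round).
- by rewrite subnn.
exists E0, v; split=> //.
  apply: wp_run; apply: wp_seq; apply: (wp_call run) => [//|t1 ht1].
  apply: wp_assign; split; first by rewrite Eu EE0.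
  rewrite /first_stage_time; suff : (m.+1 * (online_time + best_system_time + 7).+2 <=
    S.+1 * (online_time + best_system_time + 7).+2)%N by lia.
  by rewrite leq_mul2r ltnS mS orbT.
(* After [m.+1] rounds not all of them can have been expensive. *)
move=> a0 sol feas; have [//|/expensive_rounds_bound] := prom a0 sol feas.
by rewrite ltnn.
Qed.
End InstanceRuns.

(** * Input sizes, the overall time bound and the assembled algorithm *)

Section InstanceSize.
Variables (R : realFieldType) (C : covering_family R) (x : inst C).
Local Notation sz := (Defs.tsize (enc_inst x)).

Lemma nelts_le_size : (nelts x <= sz)%N.
Proof. by rewrite /= tsize_enc_nat; lia. Qed.

Lemma nreqs_le_size : (nreqs x <= sz)%N.
Proof. by rewrite /= !tsize_enc_nat; lia. Qed.

Lemma tsize_node (u v : tree R) :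
  Defs.tsize (Node u v) = (Defs.tsize u + Defs.tsize v).+1.
Proof. by []. Qed.

Lemma tsize_enc_online (sigma : seq 'I_(nreqs x)) (N : nat) : (size sigma <= N)%N ->
  (Defs.tsize (enc_online sigma) <= sz + N * (sz * 2 + 2) + 2)%N.
Proof.
move=> sN; rewrite tsize_node; have := nreqs_le_size; set z := sz => nz.
have all_small : all (fun u => Defs.tsize u <= z * 2 + 1)%N
    [seq enc_nat R (nat_of_ord i) | i <- sigma].
  rewrite all_map; apply/allP => i _ /=; rewrite tsize_enc_nat.
  by have := ltn_ord i; lia.
have := tsize_enc_seq all_small; rewrite size_map.
have : (size sigma * (z * 2 + 1).+1 <= N * (z * 2 + 2))%N.
  by rewrite -addnS leq_mul2r sN orbT.
lia.
Qed.

Lemma tsize_enc_aug (S : {set 'I_(nelts x)}) (X : {set 'I_(nreqs x)}) :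
  (Defs.tsize (enc_aug S X) <= sz * 9 + 4)%N.
Proof.
rewrite !tsize_node.
have := tsize_enc_set R S; have := tsize_enc_set R X.
by have := nelts_le_size; have := nreqs_le_size; rewrite !tsize_node; lia.
Qed.

End InstanceSize.

Lemma poly_bounded_time (don doff q : nat) :
  let N S := (S * S + S).+2 in
  poly_bounded (fun S =>
    first_stage_time S (N S) (poly_bound don (S + N S * (S * 2 + 2) + 2))
      (poly_bound q S) +
    (poly_bound doff (S * 9 + 4)).+1)%N.
Proof.
rewrite /= /first_stage_time /best_system_time /greedy_time /greedy_step_time.
rewrite /scan_body_time /online_time.
by repeat first [ exact: poly_bounded_const | exact: poly_bounded_id
  | apply: poly_bounded_succ | apply: poly_bounded_add | apply: poly_bounded_mul
  | apply: poly_bounded_exp ].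
Qed.

Theorem theorem5p6 (R : realFieldType) :
  exists K : nat,
  forall (C : covering_family R) (alpha_off alpha_on : inst C -> R),
    (exists Poff : cmd, offline_algorithm alpha_off Poff) ->
    (exists Pon : cmd, online_algorithm alpha_on Pon) ->
    forall q : nat,
    exists P1 P2 : cmd,
      robust_algorithm q
        (fun x p => K%:R * ((p + 1) * alpha_off x * alpha_on x)) P1 P2.
Proof.
(* The constant comes from the threshold [2 * alpha * T] that separates cheap rounds from expensive
   ones. *)
exists 2%N => C alpha_off alpha_on [Poff [free_off [doff offP]]].
move=> [Pon [free_on [don [Aon onP]]]] q.
exists (first_stage_cmd Pon), (second_stage_cmd Poff).
have [d time_d] := poly_bounded_time don doff q.
exists d => x lambda L Sigma p O lambda1 L_q Sigma_p O_Sigma U.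
set S := Defs.tsize (enc_inst x); pose N := (S * S + S).+2.
have nS : (nreqs x <= S)%N := nreqs_le_size x.
have L_S : (L <= poly_bound q S)%N := leq_trans L_q (poly_bound_mono q nS).
pose A := online_rev (@Aon x).
have A_sat rs : satisfies (problem x) (A rs) [set i in rs].
  have [_ sat _ _] := onP x (rev rs); apply: satisfies_mono sat => //.
  by apply/subsetP => i; rewrite !inE mem_rev.
have A_mono i rs : A rs \subset A (i :: rs).
  by rewrite /A /online_rev rev_cons; case: (onP x (rev rs)).
have A_comp rs : cost (problem x) (A rs) <= alpha_on x * opt (problem x) [set i in rs].
  rewrite (_ : [set i in rs] = [set i in rev rs]); first by case: (onP x (rev rs)).
  by apply/setP => i; rewrite !inE mem_rev.
have Pon_run sigma : (size sigma <= N)%N ->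
    runs_within O Pon (enc_online sigma) (enc_set R (Aon x sigma))
      (poly_bound don (S + N * (S * 2 + 2) + 2)).
  move=> sN; apply: runs_within_oracle_free => //.
  have [run _ _ _] := onP x sigma; apply: runs_within_leq run.
  exact/poly_bound_mono/tsize_enc_online.
have [E0 [v [run1 cert best]]] := first_stage_run (nelts_le_size x) nS Pon_run L_S
  Sigma_p O_Sigma A_sat A_mono lambda1 A_comp (ltnSn _).
(* The offline answers for all sets of requirements are collected into one function, the
   augmentation part of the solution. *)
have [E EP] := fin_all_exists (fun w => offP x E0 w).
exists (E0, [ffun w => E w]); split.
- apply: runs_within_leq run1; apply: leq_trans (time_d S); exact: leq_addr.
- move=> w _ /=; rewrite ffunE; have [run2 _ _] := EP w.
  apply: wp_run; apply: (wp_call (runs_within_oracle_free O free_off run2)) => [//|t ht].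
  split=> //; apply: leq_trans (time_d S); apply: leq_trans (leq_addl _ _).
  by rewrite ltnS; apply: leq_trans ht _; apply/poly_bound_mono/tsize_enc_aug.
- by apply/forall_inP => w _ /=; rewrite ffunE; case: (EP w).
apply: (certified_ratio A_sat lambda1 A_comp _ _ cert) => //.
- by move=> S' X; have [B [_ sat cB]] := offP x S' X; exists B.
- exact: union_p_ge1.
- by move=> w; rewrite ffunE; case: (EP w).
Qed.
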